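(* Let $d\ge1$ and $\ell\ge 1$ be integers. Consider the regression model $y_i=f_0(x_i)+\varepsilon_i$, $i=1,\dots,n$, where $x_1,\dots,x_n$ are given (nonrandom) covariates in $[0,1]^d$ and the $\varepsilon_i$ are independent $N(0,\sigma^2)$ noise. Assume $f_0$ lies in $\mathcal{F}=\{1\}\oplus\mathcal{F}_1$, $\mathcal{F}_1=\bigoplus_{j=1}^{d}\bar S^{j}$, where $S^j=\{1\}\oplus\bar S^j$ is the $\ell$th-order Sobolev space of functions of $x^{(j)}\in[0,1]$. Let $\hat f\in\mathcal{F}$ be the COSSO estimate, i.e. a minimizer over $f\in\mathcal{F}$ of $$\frac1n\sum_{i=1}^n\{y_i-f(x_i)\}^2+\tau_n^2J(f),\qquad J(f)=\sum_{j=1}^{d}\|P^jf\|,$$ where $P^j$ is the orthogonal projection onto $\bar S^j$. Then, as $n\to\infty$: (i) if $f_0$ is not a constant and $\tau_n^{-1}=O_p\big(n^{\ell/(2\ell+1)}\big)\,J(f_0)^{(2\ell-1)/(4\ell+2)}$, then $\|\hat f-f_0\|_n=O_p(\tau_n)\,J(f_0)^{1/2}$; (ii) if $f_0$ is a constant, then $\|\hat f-f_0\|_n=O_p\big(\max\{n^{-\ell/(2\ell-1)}\tau_n^{-2/(2\ell-1)},\,n^{-1/2}\}\big)$.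
   Context: The $\ell$th-order Sobolev Hilbert space is $S_\ell=\{g:[0,1]\to\mathbb{R}:\ g,g',\dots,g^{(\ell-1)}\text{ absolutely continuous},\ g^{(\ell)}\in L_2[0,1]\}$ with norm $$\|g\|^2=\sum_{\nu=0}^{\ell-1}\Big\{\int_0^1g^{(\nu)}(t)\,dt\Big\}^2+\int_0^1\{g^{(\ell)}(t)\}^2\,dt .$$ It decomposes orthogonally as $S_\ell=\{1\}\oplus\bar S_\ell$ with $\{1\}$ the constants, so $\bar S_\ell=\{g\in S_\ell:\int_0^1 g=0\}$. $S^j$ and $\bar S^j$ are copies of $S_\ell$ and $\bar S_\ell$ consisting of functions of the $j$th coordinate $x^{(j)}$. Thus every $f\in\mathcal{F}$ is uniquely $f(x)=b+\sum_{j=1}^d f_j(x^{(j)})$ with $b\in\mathbb{R}$ and $f_j\in\bar S^j$; the norm on $\mathcal F$ is $\|f\|^2=b^2+\sum_j\|f_j\|^2$, $P^jf=f_j$, and $J(f)=\sum_j\|f_j\|$. The empirical norm is $\|f\|_n^2=\frac1n\sum_{i=1}^n f^2(x_i)$. The numbers $\tau_n>0$ are smoothing parameters. The function $f_0$ and $d,\ell,\sigma^2$ are fixed as $n\to\infty$. $O_p$ denotes stochastic boundedness. *)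

(* Defs.v *)
From HB Require Import structures.
From mathcomp Require Import all_boot all_order all_algebra.
From mathcomp Require Import all_classical all_reals all_analysis.

Set Implicit Arguments.
Unset Strict Implicit.
Unset Printing Implicit Defensive.

Import Order.TTheory GRing.Theory Num.Theory.
Import numFieldNormedType.Exports.

Local Open Scope classical_set_scope.
Local Open Scope ring_scope.

Section Sobolev.
Context {R : realType}.
Implicit Types g : R -> R.

Definition I01 : set R := `[0, 1].

(* Functions on [0,1] are represented by total functions R -> R; every notion
   below depends on their values on [0,1] only. In particular derivatives at 0
   and 1 are one-sided, since the increment stays inside [0,1]. *)
Definition diff_quot g (t s : R) : R := (g s - g t) / (s - t).

Definition derivable01 g (t : R) : Prop :=
  cvg (diff_quot g t @ within I01 t^').

Definition derive01 g (t : R) : R :=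
  lim (diff_quot g t @ within I01 t^').

Definition derive01n (k : nat) g : R -> R := iter k derive01 g.

Definition abs_continuous01 g : Prop :=
  forall e : R, 0 < e -> exists2 dlt : R, 0 < dlt &
    forall (m : nat) (a b : 'I_m -> R),
      (forall i, 0 <= a i /\ a i <= b i /\ b i <= 1) ->
      trivIset setT (fun i => `]a i, b i[%classic) ->
      \sum_i (b i - a i) < dlt ->
      \sum_i `|g (b i) - g (a i)| < e.

Definition L2_01 g : Prop :=
  measurable_fun I01 g /\
  lebesgue_measure.-integrable I01 (fun t => ((g t) ^+ 2)%:E).

(* g^(k) exists everywhere for k < l, and almost everywhere for k = l *)
Definition sobolev (l : nat) : set (R -> R) := [set g |
  [/\ forall k t, (k.+1 < l)%N -> I01 t ->
        derivable01 (derive01n k g) t,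
      forall k, (k < l)%N -> abs_continuous01 (derive01n k g),
      {ae lebesgue_measure, forall t : R, I01 t ->
        derivable01 (derive01n l.-1 g) t}
    & L2_01 (derive01n l g)]].

Definition sobolev_norm (l : nat) g : R := Num.sqrt (
  \sum_(k < l) (\int[lebesgue_measure]_(t in I01) derive01n k g t) ^+ 2 +
  \int[lebesgue_measure]_(t in I01) (derive01n l g t) ^+ 2).

Definition sobolev0 (l : nat) : set (R -> R) :=
  sobolev l `&` [set g | \int[lebesgue_measure]_(t in I01) g t = 0].

End Sobolev.

Section Cosso.
Context {R : realType} {d : nat}.
Implicit Types f : 'rV[R]_d -> R.

Definition unit_cube : set 'rV[R]_d :=
  [set x | forall j, 0 <= x ord0 j <= 1].

Definition additive_decomposition (l : nat) f
    (bg : R * ('I_d -> R -> R)) : Prop :=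
  (forall j, sobolev0 l (bg.2 j)) /\
  (forall x, unit_cube x -> f x = bg.1 + \sum_j bg.2 j (x ord0 j)).

Definition cosso_space (l : nat) : set ('rV[R]_d -> R) :=
  [set f | exists bg, additive_decomposition l f bg].

(* P^j f = f_j. For f in cosso_space the decomposition chosen by get is unique
   on [0,1]. *)
Definition component (l : nat) (j : 'I_d) f : R -> R :=
  (get (additive_decomposition l f)).2 j.

Definition cosso_penalty (l : nat) f : R :=
  \sum_(j < d) sobolev_norm l (component l j f).

Definition cosso_objective (l n : nat) (x : 'I_n -> 'rV[R]_d) (y : 'I_n -> R)
    (tau : R) f : R :=
  n%:R^-1 * \sum_i (y i - f (x i)) ^+ 2 + tau ^+ 2 * cosso_penalty l f.

Definition is_cosso_estimate (l n : nat) (x : 'I_n -> 'rV[R]_d)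
    (y : 'I_n -> R) (tau : R) f : Prop :=
  cosso_space l f /\
  forall h, cosso_space l h ->
    cosso_objective l x y tau f <= cosso_objective l x y tau h.

Definition empirical_norm (n : nat) (x : 'I_n -> 'rV[R]_d) f : R :=
  Num.sqrt (n%:R^-1 * \sum_i (f (x i)) ^+ 2).

Definition constant_on_cube f : Prop :=
  exists c : R, forall x, unit_cube x -> f x = c.

End Cosso.

Section Probability.
Context {dT : measure_display} {T : measurableType dT} {R : realType}
  (P : probability T R).

Definition mutually_independent (n : nat) (X : 'I_n -> {RV P >-> R}) : Prop :=
  forall (J : {set 'I_n}) (A : 'I_n -> set R),
    (forall i, measurable (A i)) ->
    P (\bigcap_(i in [set` J]) (X i @^-1` A i)) =
    (\prod_(i in J) P (X i @^-1` A i))%E.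

Definition normal_law (X : {RV P >-> R}) (m sigma : R) : Prop :=
  forall A : set R, measurable A -> distribution P X A = normal_prob m sigma A.

(* X_n = O_p(r_n). Stated with outer probability, so that X n need not be
   measurable; for measurable X n and r n this is the usual
   P(|X_n| > C r_n) <= e. *)
Definition bigOp (X r : nat -> T -> R) : Prop :=
  forall e : R, 0 < e -> exists2 C : R, 0 < C &
    \forall n \near \oo, exists2 B : set T,
      measurable B /\ (P B <= e%:E)%E &
      [set w | C * r n w < `|X n w|] `<=` B.

End Probability.

(* Main.v *)
Require Import Defs.
From HB Require Import structures.
From mathcomp Require Import all_boot all_order all_algebra.
From mathcomp Require Import all_classical all_reals all_analysis.
From mathcomp Require Import measurable_realfun.
From mathcomp Require Import zify ring lra.

(** The error of the COSSO estimate is decided by how well the noise can imitate a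
function of small penalty. Let g be the vector of values of fhat - f0 on the
design, (u, v)_n the empirical product, and J the penalty. Comparing the
objective at fhat and at f0 gives
   |g|_n^2 + tau^2 J(fhat) <= 2 (eps, g)_n + tau^2 J(f0),
so everything rests on a bound of (eps, g)_n that holds for all admissible
functions and at all scales at once.

Approximation. For every N there is a subspace of R^n of dimension O(N), fixed
by the design alone, that contains an N^-l J(f) approximation of each f
([piecewise_taylor], [cosso_approximation]). It consists of piecewise
polynomials. The design points may cluster, so equal cells would lose a factor
N^(1/2); the cells are instead made short and of small cardinality at the same
time. On one cell the Taylor remainder is bounded by the L2 norm of g^(l)
([sobolev_taylor]), which for l = 1 is the fundamental theorem of calculus for
absolutely continuous functions, obtained here in the form of a monotonicity
criterion ([ae_slope_ge0_nondecreasing]).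

Noise. The projection of the noise on a subspace of dimension p has the
exponential tails of a chi-square variable with p degrees of freedom
([gaussian_quadratic_mgf]). These tails are summable along dyadic dimensions
2^k, so outside an event of small probability the inequality
(eps . h)^2 <= C 2^k |h|^2 holds for every k and every h in the k-th
approximation space ([gaussian_dyadic_tail]).

Chaining. Writing g = h_K + (h_{K+1} - h_K) + ... with h_k the approximation of
g by 2^k cells yields, on that event and for every K,
   |(eps, g)_n| <= C n^(-1/2) (2^(K/2) |g|_n + 2^(-K(l-1/2)) (J(fhat) + J(f0)))
([chaining], [cosso_noise_bound]). As this holds for all K simultaneously, K may
depend on the random tau: the least K for which the last term is absorbed by
tau^2 (J(fhat) + J(f0)) gives the oracle inequality
   |g|_n <= C (rate + tau J(f0)^(1/2)),
where rate is the maximum of n^(-l/(2l-1)) tau^(-2/(2l-1)) and n^(-1/2)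
([cosso_oracle]). If f0 is constant then J(f0) = 0 and this is the second
claim. In the first claim J(f0) is a fixed constant and the lower bound on tau
makes the rate O(tau) ([rate_le]). *)

Set Implicit Arguments.
Unset Strict Implicit.
Unset Printing Implicit Defensive.

Import Order.TTheory GRing.Theory Num.Theory.
Import numFieldNormedType.Exports.

Local Open Scope classical_set_scope.
Local Open Scope ring_scope.

(** * Integrals that depend only on a law *)

Section transfer.
Import HBNNSimple.

Lemma ge0_integral_simple_comp d (T : measurableType d) (R : realType)
    (mu : {measure set T -> \bar R}) (w X : T -> R)
    (mw : measurable_fun setT w) (w0 : forall t, 0 <= w t)
    (mX : measurable_fun setT X) (h : {nnsfun R >-> R}) :
  (\int[mu]_t (w t * h (X t))%:E =
   \sum_(r \in range h) r%:E *
      \int[mu]_t (w t * \1_(h @^-1` [set r]) (X t))%:E)%E.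
Proof.
have m1 r : measurable_fun setT
    (EFin \o (fun t => w t * \1_(h @^-1` [set r]) (X t))).
  apply/measurable_EFinP; apply: measurable_funM => //.
  have m : measurable_fun setT (\1_(h @^-1` [set r]) : R -> R).
    exact: measurable_indic.
  exact: measurableT_comp m mX.
have -> : (fun t => (w t * h (X t))%:E) = (fun t => \sum_(r \in range h)
   (r * (w t * \1_(h @^-1` [set r]) (X t)))%:E)%E.
  apply/funext => t; rewrite fsumEFin // [in LHS](fimfunE h (X t)); congr EFin.
  rewrite mulrC mulr_fsuml; apply: eq_fsbigr => r _; ring.
(* The positive part makes the summands nonnegative for every r, in the range
   or not. *)
transitivity (\int[mu]_t (\sum_(r \in range h)
   ((Num.max r 0) * (w t * \1_(h @^-1` [set r]) (X t)))%:E))%E.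
  apply: eq_integral => t _; apply: eq_fsbigr => r /[!inE] -[x _ <-].
  by rewrite max_l.
rewrite ge0_integral_fsum //.
- apply: eq_fsbigr => r /[!inE] -[x _ <-].
  rewrite max_l // -ge0_integralZl_EFin //; last exact: m1.
  by move=> t _; rewrite lee_fin mulr_ge0.
- move=> q; under eq_fun do rewrite EFinM.
  exact: (measurable_funeM (Num.max q 0)%:E (m1 q)).
- by move=> q t _; rewrite lee_fin !mulr_ge0 // le_max lexx orbT.
Qed.

(** A nonnegative measurable f is an increasing limit of simple functions, and on
simple functions both sides are combinations of the values on indicators. It is
applied with a product of other factors as weight (independence) and with a
probability density as weight (change of variables), which avoids having to
build the corresponding image measures. *)
Lemma ge0_integral_comp_transfer d1 d2 (T1 : measurableType d1)
    (T2 : measurableType d2) (R : realType)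
    (mu1 : {measure set T1 -> \bar R}) (mu2 : {measure set T2 -> \bar R})
    (w1 X1 : T1 -> R) (w2 X2 : T2 -> R)
    (mw1 : measurable_fun setT w1) (w10 : forall t, 0 <= w1 t)
    (mX1 : measurable_fun setT X1)
    (mw2 : measurable_fun setT w2) (w20 : forall t, 0 <= w2 t)
    (mX2 : measurable_fun setT X2) :
  (forall A : set R, measurable A ->
    \int[mu1]_t (w1 t * \1_A (X1 t))%:E =
    \int[mu2]_t (w2 t * \1_A (X2 t))%:E)%E ->
  forall f : R -> R, measurable_fun setT f -> (forall r, 0 <= f r) ->
    (\int[mu1]_t (w1 t * f (X1 t))%:E = \int[mu2]_t (w2 t * f (X2 t))%:E)%E.
Proof.
move=> H f mf f0.
have mf' : measurable_fun setT (EFin \o f) by apply/measurable_EFinP.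
pose g := nnsfun_approx measurableT mf'.
have conv d (T : measurableType d) (mu : {measure set T -> \bar R})
    (w X : T -> R) : measurable_fun setT w -> (forall t, 0 <= w t) ->
    measurable_fun setT X ->
    (\int[mu]_t (w t * g n (X t))%:E)%E @[n --> \oo] -->
    (\int[mu]_t (w t * f (X t))%:E)%E.
  move=> mw w0 mX.
  have -> : (\int[mu]_t (w t * f (X t))%:E =
      \int[mu]_t limn (fun n => (w t * g n (X t))%:E))%E.
    apply: eq_integral => t _; apply/esym/cvg_lim => //.
    under eq_fun do rewrite EFinM; rewrite EFinM.
    apply: cvgeZl => //.
    by apply: (cvg_nnsfun_approx measurableT mf') => // y _; rewrite lee_fin.
  apply: cvg_monotone_convergence => //.
  - move=> n; apply/measurable_EFinP/measurable_funM => //.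
    exact: (@measurableT_comp _ _ _ _ _ _ (g n)).
  - by move=> n t _; rewrite lee_fin mulr_ge0.
  - move=> t _ m n mn; rewrite lee_fin ler_wpM2l //.
    by have /lefP := nd_nnsfun_approx measurableT mf' mn; exact.
have c1 := conv _ _ mu1 _ _ mw1 w10 mX1.
have := conv _ _ mu2 _ _ mw2 w20 mX2.
suff -> : (fun n => \int[mu2]_t (w2 t * g n (X2 t))%:E)%E =
  (fun n => \int[mu1]_t (w1 t * g n (X1 t))%:E)%E.
  by move=> c2; rewrite -(cvg_lim _ c1) // -(cvg_lim _ c2).
apply/funext => n.
rewrite !ge0_integral_simple_comp //.
by apply: eq_fsbigr => r _; rewrite H.
Qed.

End transfer.

(** * Expectations of products *)

Section indep.
Context d (T : measurableType d) (R : realType) (P : probability T R) (n : nat).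
Variable X : 'I_n -> {RV P >-> R}.
Hypothesis indX : mutually_independent X.
Implicit Types f : 'I_n -> R -> R.

(** Independence of events is the case in which every factor is an indicator
(k = 0). Each step frees one more factor: with the others fixed, both sides
depend on it through its law only, and they agree when it is an indicator. *)
Let expectation_prod_step (k : nat) f :
  (forall i, measurable_fun setT (f i)) -> (forall i r, 0 <= f i r) ->
  (forall i, \int[P]_w (f i (X i w))%:E < +oo)%E ->
  (forall i : 'I_n, (k <= i)%N ->
    exists2 A : set R, measurable A & f i = \1_A) ->
  (\int[P]_w (\prod_i f i (X i w))%:E = \prod_i \int[P]_w (f i (X i w))%:E)%E.
Proof.
elim: k f => [|k IH] f mf f0 fin_f ind_f.
  have /choice[A HA] : forall i, exists A : set R, measurable A /\ f i = \1_A.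
    by move=> i; have [A mA fA] := ind_f i isT; exists A.
  have mXA i : measurable (X i @^-1` A i).
    by rewrite -[_ @^-1` _]setTI; apply: (measurable_funP (X i)) => //; case: (HA i).
  transitivity (\int[P]_w (\1_(\bigcap_(i in [set` [set: 'I_n]%SET])
      (X i @^-1` A i)) w)%:E)%E.
    apply: eq_integral => w _; congr EFin; rewrite indicE.
    have [win|wout] := boolP (w \in _).
      apply: big1 => i _; rewrite (HA i).2 indicE mem_set //.
      by move: win; rewrite inE => /(_ i); apply; rewrite /= inE.
    have [i Hi] : exists i, ~ A i (X i w).
      apply/existsNP => H; move/negP: wout; apply; rewrite inE => i _; exact: H.
    by rewrite (bigD1 i) //= (HA i).2 indicE memNset // mul0r.
  rewrite integral_indic ?setIT //; last first.
    apply: fin_bigcap_measurable => //.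
  have /= -> := indX [set: 'I_n]%SET (fun i => (HA i).1).
  rewrite big_mkcond /=; apply: eq_bigr => i _; rewrite inE (HA i).2.
  have -> : (fun w => (\1_(A i) (X i w))%:E) = (fun w => (\1_(X i @^-1` A i) w)%:E).
    by move=> t; apply/funext => w.
  by rewrite integral_indic ?setIT.
have [nk|kn] := leqP n k.
  by apply: IH => // i ki; have := leq_ltn_trans (leq_trans nk ki) (ltn_ord i); rewrite ltnn.
pose i0 := Ordinal kn.
have mfX i : measurable_fun setT (fun w => f i (X i w)).
  by apply: measurableT_comp.
have fin i : (\int[P]_w (f i (X i w))%:E \is a fin_num)%E.
  rewrite ge0_fin_numE //.
  by apply: integral_ge0 => w _; rewrite lee_fin.
have intE i : (\int[P]_w (f i (X i w))%:E = (fine (\int[P]_w (f i (X i w))%:E))%:E)%E.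
  by rewrite fineK.
pose c := \prod_(i | i != i0) fine (\int[P]_w (f i (X i w))%:E)%E.
have c0 : 0 <= c.
  apply: prodr_ge0 => i _; apply/fine_ge0/integral_ge0 => w _.
  by rewrite lee_fin.
pose F w := \prod_(i | i != i0) f i (X i w).
have F0 w : 0 <= F w by exact: prodr_ge0.
have mF : measurable_fun setT F.
  rewrite /F; under eq_fun do rewrite big_mkcond.
  by apply: measurable_prod => i _; case: (i != i0).
have -> : (\int[P]_w (\prod_i f i (X i w))%:E =
           \int[P]_w (F w * f i0 (X i0 w))%:E)%E.
  by apply: eq_integral => w _; rewrite (bigD1 i0) //= mulrC.
rewrite (@ge0_integral_comp_transfer _ _ _ _ _ P P _ _ (cst c) (X i0)) //.
  under eq_integral do rewrite EFinM.
  rewrite ge0_integralZl_EFin //; last 2 first.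
  - by move=> w _; rewrite lee_fin.
  - exact/measurable_EFinP.
  rewrite [RHS](bigD1 i0) //= muleC; congr (_ * _)%E.
  rewrite /c -prodEFin.
  by apply: eq_bigr => i _; rewrite -intE.
move=> A mA.
pose g i := if i == i0 then \1_A else f i.
have -> : (\int[P]_w (F w * \1_A (X i0 w))%:E =
           \int[P]_w (\prod_i g i (X i w))%:E)%E.
  apply: eq_integral => w _; congr EFin; rewrite [RHS](bigD1 i0) //= /g eqxx.
  by rewrite mulrC; congr (_ * _); apply: eq_bigr => i ii0; rewrite (negPf ii0).
have m1 : measurable_fun setT (\1_A : R -> R) by exact: measurable_indic.
rewrite IH; first last.
- move=> i ki; rewrite /g; have [_|ii0] := eqVneq i i0; first by exists A.
  apply: ind_f; rewrite ltn_neqAle ki andbT.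
  by apply: contraNneq ii0 => ki0; apply/eqP/val_inj.
- move=> i; rewrite /g; have [->|ii0] := eqVneq i i0 => //.
  apply: (@le_lt_trans _ _ (\int[P]_w (cst 1%E w)))%E; last first.
    rewrite integral_cst // mul1e.
    by apply: le_lt_trans (ltry 1); exact: probability_le1.
  apply: ge0_le_integral => //.
  + by apply/measurable_EFinP; exact: measurableT_comp m1 _.
  + by move=> w _ /=; rewrite lee_fin indicE lern1 leq_b1.
- by move=> i r; rewrite /g; case: ifP.
- by move=> i; rewrite /g; case: ifP.
rewrite (bigD1 i0) //= /g eqxx muleC.
under [in RHS]eq_integral do rewrite EFinM.
rewrite ge0_integralZl_EFin //; last first.
  by apply/measurable_EFinP; exact: measurableT_comp m1 _.
congr (_ * _)%E; rewrite /c -prodEFin.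
by apply: eq_bigr => i ii0; rewrite (negPf ii0) -intE.
Qed.

Lemma expectation_prod_indep f :
  (forall i, measurable_fun setT (f i)) -> (forall i r, 0 <= f i r) ->
  (forall i, \int[P]_w (f i (X i w))%:E < +oo)%E ->
  (\int[P]_w (\prod_i f i (X i w))%:E = \prod_i \int[P]_w (f i (X i w))%:E)%E.
Proof.
move=> mf f0 fin_f; apply: (@expectation_prod_step n) => // i.
by rewrite leqNgt ltn_ord.
Qed.

End indep.

(** * Euclidean geometry of design vectors *)

Section dot.
Context {R : realType} {n : nat}.
Implicit Types u v w : 'rV[R]_n.

Definition dot u v : R := \sum_i u ord0 i * v ord0 i.

Lemma dotC u v : dot u v = dot v u.
Proof. by apply: eq_bigr => i _; rewrite mulrC. Qed.

Lemma dotDl u v w : dot (u + v) w = dot u w + dot v w.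
Proof.
by rewrite /dot -big_split; apply: eq_bigr => i _; rewrite mxE mulrDl.
Qed.

Lemma dotZl c u v : dot (c *: u) v = c * dot u v.
Proof. by rewrite /dot mulr_sumr; apply: eq_bigr => i _; rewrite mxE mulrA. Qed.

Lemma dotNl u v : dot (- u) v = - dot u v.
Proof. by rewrite -scaleN1r dotZl mulN1r. Qed.

Lemma dotBl u v w : dot (u - v) w = dot u w - dot v w.
Proof. by rewrite dotDl dotNl. Qed.

Lemma dotDr u v w : dot u (v + w) = dot u v + dot u w.
Proof. by rewrite ![dot u _]dotC dotDl. Qed.

Lemma dotZr c u v : dot u (c *: v) = c * dot u v.
Proof. by rewrite ![dot u _]dotC dotZl. Qed.

Lemma dotNr u v : dot u (- v) = - dot u v.
Proof. by rewrite ![dot u _]dotC dotNl. Qed.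

Lemma dot0l u : dot 0 u = 0.
Proof. by rewrite -(scale0r 0) dotZl mul0r. Qed.

Lemma dot_suml (I : Type) (r : seq I) (Q : pred I) (F : I -> 'rV[R]_n) v :
  dot (\sum_(i <- r | Q i) F i) v = \sum_(i <- r | Q i) dot (F i) v.
Proof.
elim/big_ind2 : _ => [|x1 x2 y1 y2 <- <-|//]; first exact: dot0l.
exact: dotDl.
Qed.

Lemma dot_ge0 u : 0 <= dot u u.
Proof. by apply: sumr_ge0 => i _; rewrite -expr2 sqr_ge0. Qed.

Lemma dot_eq0 u : (dot u u == 0) = (u == 0).
Proof.
apply/idP/eqP => [|->]; last by rewrite dot0l.
rewrite psumr_eq0; last by move=> i _; rewrite -expr2 sqr_ge0.
move/allP => H; apply/rowP => i; rewrite mxE; apply/eqP.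
by have := H i; rewrite mem_index_enum mulf_eq0 orbb; exact.
Qed.

Definition orthonormal (us : seq 'rV[R]_n) :=
  pairwise (fun u v => dot u v == 0) us && all (fun u => dot u u == 1) us.

End dot.

Lemma sum_cauchy_schwarz (R : realFieldType) (I : Type) (r : seq I) (a b : I -> R) :
  (\sum_(i <- r) a i * b i) ^+ 2 <=
  (\sum_(i <- r) a i ^+ 2) * (\sum_(i <- r) b i ^+ 2).
Proof.
elim: r => [|i r IH]; first by rewrite !big_nil expr0n mul0r.
rewrite !big_cons.
have := sumr_ge0 r (fun i (_ : xpredT i) => sqr_ge0 (a i)).
have := sumr_ge0 r (fun i (_ : xpredT i) => sqr_ge0 (b i)).
move: IH; set A := \sum_(j <- r) _ * _; set p := \sum_(j <- r) _.
set q := \sum_(j <- r) _ => IH q0 p0.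
suff : 2 * A * (a i * b i) <= p * b i ^+ 2 + q * a i ^+ 2 by nra.
apply: le_trans (ler_norm _) _.
rewrite -[leRHS]ger0_norm; last by rewrite addr_ge0 // mulr_ge0 // sqr_ge0.
rewrite -ler_sqr ?nnegrE // !real_normK ?num_real //.
have : A ^+ 2 * (a i * b i) ^+ 2 <= p * q * (a i * b i) ^+ 2.
  by rewrite ler_wpM2r // sqr_ge0.
have := sqr_ge0 (p * b i ^+ 2 - q * a i ^+ 2).
by nra.
Qed.

Section orthonormal_basis.
Context {R : realType} {n : nat}.
Implicit Types (u v h : 'rV[R]_n) (us vs : seq 'rV[R]_n).

Lemma dot_proj us v : orthonormal us -> v \in us ->
  forall h, dot (h - \sum_(u <- us) dot h u *: u) v = 0.
Proof.
move=> /andP[]; elim: us => //= u us IH /andP[uus pus] /andP[/eqP uu aus].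
rewrite inE => vus h; rewrite big_cons opprD addrA dotBl.
have [vus'|vus'] := boolP (v \in us).
  have := IH pus aus vus' h; rewrite !dotBl dotZl.
  have /allP/(_ v vus')/eqP -> := uus.
  by rewrite mulr0 subr0.
have /eqP -> : v == u by move: vus; rewrite (negPf vus') orbF.
rewrite dotBl dotZl uu dot_suml big1_seq ?subr0 ?mulr1 ?subrr // => w /andP[_ wus].
rewrite dotZl dotC.
by have /allP/(_ w wus)/eqP := uus; rewrite dotC => ->; rewrite mulr0.
Qed.

(** A vector that depends on its predecessors is skipped, so the family may be
shorter than the original list. *)
Lemma gram_schmidt vs : exists us, [/\ orthonormal us, (size us <= size vs)%N &
  {in vs, forall v, v = \sum_(u <- us) dot v u *: u}].
Proof.
elim: vs => [|v vs [us [ous sus Hus]]]; first by exists [::].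
pose r := v - \sum_(u <- us) dot v u *: u.
have ru u : u \in us -> dot r u = 0 by move=> uus; exact: dot_proj.
have [r0|r0] := eqVneq r 0.
  exists us; split => //; first exact: leqW.
  move=> w; rewrite inE => /orP[/eqP ->|/Hus//].
  by apply/eqP; rewrite -subr_eq0; apply/eqP.
have rr : 0 < dot r r by rewrite lt_neqAle dot_ge0 eq_sym dot_eq0 r0.
pose q := (Num.sqrt (dot r r))^-1 *: r.
have q2 : (Num.sqrt (dot r r))^-1 ^+ 2 * dot r r = 1.
  by rewrite exprVn sqr_sqrtr ?(ltW rr) // mulVf // gt_eqF.
exists (q :: us); split => //=.
- case/andP: (ous) => pus aus.
  apply/andP; split => /=; apply/andP; split => //.
    by apply/allP => u uus; rewrite dotZl (ru u) // mulr0.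
  by rewrite dotZl dotZr mulrA -expr2 q2.
- move=> w; rewrite inE big_cons => /orP[/eqP ->|wvs].
    have {1}-> : v = r + \sum_(u <- us) dot v u *: u by rewrite subrK.
    congr (_ + _).
    have -> : dot v q = (Num.sqrt (dot r r))^-1 * dot r r.
      rewrite dotZr; congr (_ * _).
      have {1}-> : v = r + \sum_(u <- us) dot v u *: u by rewrite subrK.
      rewrite dotDl dot_suml big1_seq ?addr0 // => u /andP[_ uus].
      by rewrite dotZl (dotC u r) (ru u) // mulr0.
    by rewrite scalerA mulrAC -expr2 q2 scale1r.
  have -> : dot w q = 0.
    rewrite dotZr (Hus w wvs) dot_suml big1_seq ?mulr0 // => u /andP[_ uus].
    by rewrite dotZl (dotC u r) (ru u) // mulr0.
  by rewrite scale0r add0r -Hus.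
Qed.

Lemma orthonormal_basis (U : {vspace 'rV[R]_n}) : exists us,
  [/\ orthonormal us, (size us <= \dim U)%N &
   {in U, forall v, v = \sum_(u <- us) dot v u *: u}].
Proof.
have [us [ous sus Hus]] := gram_schmidt (vbasis U).
exists us; split => //; first by rewrite size_tuple in sus.
move=> v vU; rewrite {1}(coord_vbasis vU).
transitivity (\sum_(i < \dim U) coord (vbasis U) i v *:
    \sum_(u <- us) dot (vbasis U)`_i u *: u).
  by apply: eq_bigr => i _; congr (_ *: _); apply: Hus; rewrite mem_nth ?size_tuple.
under eq_bigr do rewrite scaler_sumr.
rewrite exchange_big /=; apply: eq_bigr => u _.
under eq_bigr do rewrite scalerA.
rewrite -scaler_suml; congr (_ *: _).
rewrite [in RHS](coord_vbasis vU) dot_suml.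
by apply: eq_bigr => i _; rewrite dotZl.
Qed.

(** Cauchy-Schwarz in the coordinates of an orthonormal family whose span
contains h: only the part of v inside this span matters. *)
Lemma dot_sqr_le (us : seq 'rV[R]_n) v h : orthonormal us ->
  h = \sum_(u <- us) dot h u *: u ->
  dot h v ^+ 2 <= (\sum_(u <- us) dot u v ^+ 2) * dot h h.
Proof.
move=> ous hE.
have dE w : dot h w = \sum_(u <- us) dot h u * dot u w.
  by rewrite {1}hE dot_suml; apply: eq_bigr => u _; rewrite dotZl.
have -> : dot h h = \sum_(u <- us) dot h u ^+ 2.
  by rewrite dE; apply: eq_bigr => u _; rewrite (dotC u h).
by rewrite dE mulrC sum_cauchy_schwarz.
Qed.
End orthonormal_basis.

Section enorm.
Context {R : realType} {n : nat}.
Implicit Types u v h e g : 'rV[R]_n.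

Definition enorm u : R := Num.sqrt (dot u u).

Lemma enorm_ge0 u : 0 <= enorm u. Proof. exact: sqrtr_ge0. Qed.

Lemma sqr_enorm u : enorm u ^+ 2 = dot u u.
Proof. by rewrite sqr_sqrtr // dot_ge0. Qed.

Lemma enorm0 : enorm 0 = 0.
Proof. by rewrite /enorm dot0l sqrtr0. Qed.

Lemma enormN u : enorm (- u) = enorm u.
Proof. by rewrite /enorm dotNl dotNr opprK. Qed.

Lemma dot_le_enorm u v : `|dot u v| <= enorm u * enorm v.
Proof.
rewrite -ler_sqr ?nnegrE ?mulr_ge0 ?enorm_ge0 // real_normK ?num_real //.
rewrite exprMn !sqr_enorm; apply: le_trans (sum_cauchy_schwarz _ _ _) _.
by rewrite /dot; under eq_bigr do rewrite expr2;
  under [X in _ * X]eq_bigr do rewrite expr2.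
Qed.

Lemma enormD u v : enorm (u + v) <= enorm u + enorm v.
Proof.
rewrite -ler_sqr ?nnegrE ?addr_ge0 ?enorm_ge0 // sqr_enorm sqrrD !sqr_enorm.
rewrite dotDl !dotDr (dotC v u); have := dot_le_enorm u v; rewrite ler_norml.
by move=> /andP[_]; lra.
Qed.

Lemma enormB u v : enorm (u - v) <= enorm u + enorm v.
Proof. by rewrite -(enormN v) enormD. Qed.

Lemma enorm_sum (I : Type) (r : seq I) (F : I -> 'rV[R]_n) :
  enorm (\sum_(i <- r) F i) <= \sum_(i <- r) enorm (F i).
Proof.
elim/big_ind2 : _ => [|u a v b ua vb|//]; first by rewrite enorm0.
by apply: le_trans (enormD _ _) _; exact: lerD.
Qed.

End enorm.

(** * Gaussian noise on subspaces *)

Section gaussian_mgf.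
Context {R : realType}.
Notation mu := (@lebesgue_measure R).

(** Completing the square turns the integrand into the normal density with mean
a s^2. *)
Lemma integral_normal_pdf_expR (s a : R) : s != 0 ->
  (\int[mu]_x (normal_pdf 0 s x * expR (a * x))%:E =
   (expR (s ^+ 2 * a ^+ 2 / 2))%:E)%E.
Proof.
move=> s0.
transitivity (\int[mu]_x ((expR (s ^+ 2 * a ^+ 2 / 2))%:E *
    (normal_pdf (a * s ^+ 2) s x)%:E))%E.
  apply: eq_integral => x _; rewrite -EFinM; congr EFin.
  rewrite !normal_pdfE // mulrCA -!mulrA; congr (_ * _).
  rewrite /normal_fun -!expRD; congr expR; field.
  by rewrite s0.
rewrite ge0_integralZl_EFin ?expR_ge0 //.
- by rewrite integral_normal_pdf mule1.
- by move=> x _; rewrite lee_fin normal_pdf_ge0.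
- by apply/measurable_EFinP; exact: measurable_normal_pdf.
Qed.

(** Up to the factor sqrt 2 the integrand is the normal density of variance 2. *)
Lemma integral_normal_pdf_expR_sqr :
  (\int[mu]_x (normal_pdf 0 1 x * expR (x ^+ 2 / 4))%:E =
   (Num.sqrt 2)%:E)%E.
Proof.
have s2 : Num.sqrt 2 != 0 :> R by rewrite gt_eqF // sqrtr_gt0.
transitivity (\int[mu]_x ((Num.sqrt 2)%:E *
    (normal_pdf 0 (Num.sqrt 2) x)%:E))%E.
  apply: eq_integral => x _; rewrite -EFinM; congr EFin.
  rewrite !normal_pdfE ?oner_eq0 // -[LHS]mulrA [RHS]mulrA; congr (_ * _); last first.
    rewrite /normal_fun -expRD; congr expR; rewrite sqr_sqrtr //; by field.
  rewrite /normal_peak expr1n mul1r sqr_sqrtr // -mulrnAr.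
  by rewrite sqrtrM // invfM mulrA mulfV // mul1r.
rewrite ge0_integralZl_EFin ?sqrtr_ge0 //.
- by rewrite integral_normal_pdf mule1.
- by move=> x _; rewrite lee_fin normal_pdf_ge0.
- by apply/measurable_EFinP; exact: measurable_normal_pdf.
Qed.

Lemma normal_law_integral d (T : measurableType d) (P : probability T R)
    (X : {RV P >-> R}) (m s : R) (f : R -> R) :
  normal_law X m s -> measurable_fun setT f -> (forall r, 0 <= f r) ->
  (\int[P]_w (f (X w))%:E = \int[mu]_x (normal_pdf m s x * f x)%:E)%E.
Proof.
move=> lawX mf f0.
transitivity (\int[P]_w (cst 1 w * f (X w))%:E)%E.
  by apply: eq_integral => w _; rewrite mul1r.
rewrite (@ge0_integral_comp_transfer _ _ _ _ _ P mu _ _ (normal_pdf m s) id) //.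
- exact: measurable_normal_pdf.
- by move=> t; exact: normal_pdf_ge0.
move=> A mA.
transitivity (P (X @^-1` A)).
  have -> : (fun w => (cst 1 w * \1_A (X w))%:E) =
      (fun w => (\1_(X @^-1` A) w)%:E) :> (T -> \bar R).
    by apply/funext => w; rewrite mul1r.
  rewrite integral_indic ?setIT // -[_ @^-1` _]setTI.
  exact: (measurable_funP X).
transitivity (normal_prob m s A); first exact: lawX.
rewrite /normal_prob [LHS]integral_mkcond; apply: eq_integral => x _.
rewrite patchE indicE; case: ifP => _; first by rewrite mulr1.
by rewrite mulr0.
Qed.

Section vector.
Context d (T : measurableType d) (P : probability T R) (n : nat).
Variables (X : 'I_n -> {RV P >-> R}) (s : R).
Hypothesis s0 : 0 < s.
Hypothesis indX : mutually_independent X.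
Hypothesis lawX : forall i, normal_law (X i) 0 s.

Definition sample (w : T) : 'rV[R]_n := \row_i X i w.

Lemma measurable_dot_sample a : measurable_fun setT (fun w => dot a (sample w)).
Proof.
rewrite /dot; apply: measurable_sum => i.
under eq_fun do rewrite mxE.
exact: measurable_funM.
Qed.

Lemma gaussian_linear_mgf (a : 'rV[R]_n) :
  (\int[P]_w (expR (dot a (sample w)))%:E =
   (expR (s ^+ 2 * dot a a / 2))%:E)%E.
Proof.
pose f i x := expR (a ord0 i * x).
have mf i : measurable_fun setT (f i).
  by apply: measurableT_comp => //; exact: measurable_funM.
have fE i : (\int[P]_w (f i (X i w))%:E =
    (expR (s ^+ 2 * (a ord0 i) ^+ 2 / 2))%:E)%E.
  rewrite (normal_law_integral (lawX i)) //; last by move=> r; exact: expR_ge0.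
  by rewrite integral_normal_pdf_expR // gt_eqF.
transitivity (\int[P]_w (\prod_i f i (X i w))%:E)%E.
  apply: eq_integral => w _; rewrite /f -expR_sum; congr (EFin (expR _)).
  by apply: eq_bigr => i _; rewrite mxE.
rewrite expectation_prod_indep //; last 2 first.
- by move=> i r; exact: expR_ge0.
- by move=> i; rewrite fE ltry.
under eq_bigr do rewrite fE.
rewrite prodEFin -expR_sum /dot; congr (EFin (expR _)).
rewrite mulr_sumr mulr_suml; apply: eq_bigr => i _; ring.
Qed.

(** The square of a linear form is linearized with an auxiliary standard normal
variable: exp (c^2 z^2 / 2) is the mean of exp (c z g) over g. By Tonelli the
noise is integrated first, which replaces a by a + c g u; as u is orthogonal to
the remaining vectors, the induction hypothesis applies and leaves the integral
of exp (g^2 / 4) over g, that is sqrt 2. The linear term a is there to make this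
induction possible. *)
Lemma gaussian_quadratic_mgf us a : orthonormal us ->
  {in us, forall u, dot a u = 0} ->
  (\int[P]_w (expR (dot a (sample w) +
      (4 * s ^+ 2)^-1 * \sum_(u <- us) dot u (sample w) ^+ 2))%:E =
   (expR (s ^+ 2 * dot a a / 2) * Num.sqrt 2 ^+ size us)%:E)%E.
Proof.
elim: us a => [|u us IH] a.
  move=> _ _; rewrite expr0 mulr1 -gaussian_linear_mgf.
  by apply: eq_integral => w _; rewrite big_nil mulr0 addr0.
rewrite /orthonormal /= => /andP[/andP[uus pus] /andP[/eqP uu aus]] au.
have {}IH := IH _ (introT andP (conj pus aus)).
pose c := (Num.sqrt 2 * s)^-1.
(* The scale c is chosen so that exp (c^2 z^2 / 2) is the factor of u. *)
have cs : s ^+ 2 * c ^+ 2 = 2^-1.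
  rewrite /c exprVn exprMn sqr_sqrtr //; field.
  by rewrite gt_eqF.
pose h w g := normal_pdf 0 1 g *
  expR (dot (a + (c * g) *: u) (sample w) +
      (4 * s ^+ 2)^-1 * \sum_(u <- us) dot u (sample w) ^+ 2).
have h0 w g : 0 <= h w g by rewrite mulr_ge0 ?expR_ge0 ?normal_pdf_ge0.
have mh : measurable_fun setT (fun wg : T * R => (h wg.1 wg.2)%:E).
  apply/measurable_EFinP/measurable_funM.
    by apply: measurableT_comp => //; exact: measurable_normal_pdf.
  apply: measurableT_comp => //; apply: measurable_funD.
    under eq_fun do rewrite dotDl dotZl.
    apply: measurable_funD.
      by apply: (measurableT_comp (measurable_dot_sample a)).
    apply: measurable_funM; first exact: measurable_funM.
    by apply: (measurableT_comp (measurable_dot_sample u)).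
  apply: measurable_funM => //; apply: measurable_sum => v.
  apply: measurable_funX.
  by apply: (measurableT_comp (measurable_dot_sample v)).
transitivity (\int[P]_w \int[mu]_g (h w g)%:E)%E.
  apply: eq_integral => w _; rewrite big_cons.
  set S := \sum_(j <- us) _; set z := dot u (sample w).
  transitivity (\int[mu]_g ((expR (dot a (sample w) + (4 * s ^+ 2)^-1 * S))%:E *
      (normal_pdf 0 1 g * expR (c * z * g))%:E))%E; last first.
    apply: eq_integral => g _; rewrite /h -EFinM; congr EFin.
    rewrite mulrCA -expRD; congr (_ * expR _).
    rewrite dotDl dotZl -/z -/S; ring.
  rewrite ge0_integralZl_EFin ?expR_ge0 //; last 2 first.
  - by move=> x _; rewrite lee_fin mulr_ge0 ?expR_ge0 ?normal_pdf_ge0.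
  - apply/measurable_EFinP/measurable_funM; first exact: measurable_normal_pdf.
    by apply: measurableT_comp => //; exact: measurable_funM.
  rewrite integral_normal_pdf_expR ?oner_eq0 // -EFinM -expRD.
  congr (EFin (expR _)).
  have -> : (1 ^+ 2 * (c * z) ^+ 2 / 2 = (4 * s ^+ 2)^-1 * z ^+ 2).
    have c2 : c ^+ 2 = (2 * s ^+ 2)^-1.
      by rewrite /c exprVn exprMn sqr_sqrtr.
    rewrite exprMn c2; field.
    by rewrite gt_eqF.
  ring.
transitivity (\int[mu]_g \int[P]_w (h w g)%:E)%E.
  apply: (fubini_tonelli
    (fun wg : T * measurableTypeR R => (h wg.1 wg.2)%:E)) => // wg.
  by rewrite lee_fin.
transitivity (\int[mu]_g ((expR (s ^+ 2 * dot a a / 2) * Num.sqrt 2 ^+ size us)%:E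
    * (normal_pdf 0 1 g * expR (g ^+ 2 / 4))%:E))%E; last first.
  rewrite ge0_integralZl_EFin; last 4 first.
  - exact: measurableT.
  - by move=> x _; rewrite lee_fin mulr_ge0 ?expR_ge0 ?normal_pdf_ge0.
  - apply/measurable_EFinP/measurable_funM; first exact: measurable_normal_pdf.
    by apply: measurableT_comp => //; exact: measurable_funM.
  - by rewrite mulr_ge0 ?expR_ge0 ?exprn_ge0.
  by rewrite integral_normal_pdf_expR_sqr -EFinM (exprSr _ (size us)) mulrA.
apply: eq_integral => g _; rewrite /h /=.
under eq_integral do rewrite EFinM.
rewrite ge0_integralZl_EFin ?normal_pdf_ge0 //; last first.
  apply/measurable_EFinP/measurableT_comp => //; apply: measurable_funD.
    exact: measurable_dot_sample.
  apply: measurable_funM => //; apply: measurable_sum => v.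
  by apply: measurable_funX; exact: measurable_dot_sample.
rewrite IH; last first.
  move=> v vus; rewrite dotDl dotZl (au v) ?inE ?vus ?orbT //.
  by have /allP/(_ v vus)/eqP -> := uus; rewrite mulr0 addr0.
rewrite -!EFinM; congr EFin.
rewrite [RHS]mulrCA; congr (_ * _).
rewrite [RHS]mulrAC -expRD; congr (expR _ * _).
rewrite dotDl !dotDr !dotZl !dotZr uu (dotC u a) (au u) ?inE ?eqxx //.
rewrite !mulr0 addr0 add0r mulr1.
have -> : s ^+ 2 * (dot a a + c * g * (c * g)) / 2 =
  s ^+ 2 * dot a a / 2 + (s ^+ 2 * c ^+ 2) * g ^+ 2 / 2 by ring.
rewrite cs; by field.
Qed.

End vector.
End gaussian_mgf.

Section tail.
Context {R : realType} d (T : measurableType d) (P : probability T R) (n : nat).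
Variables (X : 'I_n -> {RV P >-> R}) (s : R).
Hypothesis s0 : 0 < s.
Hypothesis indX : mutually_independent X.
Hypothesis lawX : forall i, normal_law (X i) 0 s.

(** Markov's inequality for the exponential of the squared length of the
projected noise. *)
Lemma gaussian_subspace_tail (U : {vspace 'rV[R]_n}) (p : nat) (t : R) :
  (\dim U <= p)%N ->
  exists B : set T, [/\ measurable B,
    (P B <= (Num.sqrt 2 ^+ p * expR (- (t / (4 * s ^+ 2))))%:E)%E &
    forall w, ~ B w -> {in U, forall h, dot h (sample X w) ^+ 2 <= t * dot h h}].
Proof.
move=> dimU; have [us [ous sus Hus]] := orthonormal_basis U.
pose Q w := \sum_(u <- us) dot u (sample X w) ^+ 2.
have mQ : measurable_fun setT Q.
  by apply: measurable_sum => u; apply: measurable_funX; exact: measurable_dot_sample.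
pose B := [set w | t < Q w].
have mB : measurable B.
  rewrite -[B]setTI; have -> : B = Q @^-1` `]t, +oo[%classic.
    by apply/seteqP; split => w /=; rewrite in_itv /= andbT.
  exact: mQ.
exists B; split => //; last first.
  move=> w /negP; rewrite -leNgt => Qt h hU.
  apply: le_trans (dot_sqr_le _ ous (Hus _ hU)) _.
  by rewrite ler_wpM2r // dot_ge0.
have -> : P B = (\int[P]_w (\1_B w)%:E)%E by rewrite integral_indic // setIT.
pose c := (4 * s ^+ 2)^-1.
have c0 : 0 < c by rewrite invr_gt0 mulr_gt0 // exprn_gt0.
have mE : measurable_fun setT (fun w => (expR (dot 0 (sample X w) + c * Q w))%:E).
  apply/measurable_EFinP/measurableT_comp => //; apply: measurable_funD.
    exact: measurable_dot_sample.
  exact: measurable_funM.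
apply: (@le_trans _ _ (\int[P]_w ((expR (- (t * c)))%:E *
    (expR (dot 0 (sample X w) + c * Q w))%:E))%E).
  apply: ge0_le_integral => //.
  - by apply/measurable_EFinP; exact: measurable_indic.
  - exact: measurable_funeM.
  move=> w _; rewrite -EFinM lee_fin -expRD dot0l add0r indicE.
  have [wB|wB] := boolP (w \in B); last exact: expR_ge0.
  rewrite -expR0 ler_expR addrC subr_ge0 mulrC ler_wpM2l ?(ltW c0) //.
  by move: wB; rewrite inE => /ltW.
rewrite ge0_integralZl_EFin ?expR_ge0 //.
rewrite gaussian_quadratic_mgf //; last by move=> u _; rewrite dot0l.
rewrite dot0l mulr0 mul0r expR0 mul1r -EFinM lee_fin mulrC.
rewrite ler_wpM2r ?expR_ge0 //.
apply: ler_weXn2l; last exact: leq_trans dimU.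
by rewrite -[leLHS]sqrtr1 ler_sqrt // ler1n.
Qed.
End tail.

Section uniform.
Context {R : realType} d (T : measurableType d) (P : probability T R) (n : nat).
Variables (X : 'I_n -> {RV P >-> R}) (s : R).
Hypothesis s0 : 0 < s.
Hypothesis indX : mutually_independent X.
Hypothesis lawX : forall i, normal_law (X i) 0 s.

(** The tail at dimension D 2^k is at most exp (- M 2^k) with M = 2 / e, and
exp (- x) <= 1 / x makes the sum over k at most e. *)
Lemma gaussian_dyadic_tail (U : nat -> {vspace 'rV[R]_n}) (D : nat) (e : R) :
  0 < e -> (forall k, \dim (U k) <= D * 2 ^ k)%N ->
  exists2 B : set T, measurable B /\ (P B <= e%:E)%E &
    forall w, ~ B w -> forall k, (k <= n)%N -> {in U k, forall h,
      dot h (sample X w) ^+ 2 <=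
      4 * s ^+ 2 * (D%:R + 2 / e) * 2 ^+ k * dot h h}.
Proof.
move=> e0 dimU; pose M := 2 / e.
have M0 : 0 < M by rewrite divr_gt0.
pose t k := 4 * s ^+ 2 * (D%:R + M) * 2 ^+ k.
have /choice[B HB] : forall k, exists B : set T, [/\ measurable B,
    (P B <= (Num.sqrt 2 ^+ (D * 2 ^ k) * expR (- (t k / (4 * s ^+ 2))))%:E)%E &
    forall w, ~ B w -> {in U k, forall h,
      dot h (sample X w) ^+ 2 <= t k * dot h h}].
  by move=> k; apply: gaussian_subspace_tail.
exists (\big[setU/set0]_(k < n.+1) B k); last first.
  move=> w wB k kn; have [_ _] := HB k; apply.
  apply: contra_not wB => wB; rewrite -bigcup_mkord.
  by exists k => //=; rewrite ltnS.
have mB k : measurable (B k) by case: (HB k).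
split; first by apply: bigsetU_measurable => k _.
apply: (@le_trans _ _ (\sum_(k < n.+1) P (B k))%E).
  exact: Boole_inequality.
apply: (@le_trans _ _ (\sum_(k < n.+1) (e / 2 * (2 ^- k))%:E)%E).
  apply: lee_sum => k _; have [_ /le_trans + _] := HB k; apply; rewrite lee_fin.
  have -> : t k / (4 * s ^+ 2) = (D * 2 ^ k)%:R + M * 2 ^+ k.
    rewrite /t natrM natrX; field.
    by rewrite gt_eqF.
  rewrite opprD expRD mulrA.
  have h1 : Num.sqrt 2 ^+ (D * 2 ^ k) * expR (- (D * 2 ^ k)%:R) <= 1 :> R.
    rewrite expRN ler_pdivrMr ?expR_gt0 // mul1r -[X in expR X]mul1r expRM_natr.
    apply: lerXn2r; rewrite ?nnegrE ?sqrtr_ge0 ?expR_ge0 //.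
    apply: le_trans (expR_ge1Dx 1).
    rewrite -ler_sqr ?nnegrE ?sqrtr_ge0 // sqr_sqrtr //; lra.
  apply: (@le_trans _ _ (expR (- (M * 2 ^+ k)))).
    by rewrite -[leRHS]mul1r ler_wpM2r ?expR_ge0.
  have -> : e / 2 * 2 ^- k = (M * 2 ^+ k)^-1.
    by rewrite invfM /M invf_div.
  rewrite expRN lef_pV2 ?posrE ?expR_gt0 ?(mulr_gt0 M0) ?exprn_gt0 //.
  apply: le_trans (expR_ge1Dx _); lra.
apply: (@le_trans _ _ (\sum_(k < n.+1) e / 2 * 2 ^- k)%:E).
  by rewrite -sumEFin.
rewrite lee_fin -mulr_sumr.
have -> : \sum_(i < n.+1) (2 : R) ^- i = 2 - 2 ^- n.
  elim: n => [|m IH]; first by rewrite big_ord1 expr0 invr1; lra.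
  rewrite big_ord_recr /= IH (exprS _ m) invfM; lra.
have : (0 : R) <= 2 ^- n by rewrite invr_ge0 exprn_ge0.
nra.
Qed.
End uniform.

(** * Monotonicity from the sign of the derivative *)

Section slopes.
Context {R : realType}.
Implicit Types (F G K V : R -> R) (a b t : R).
Notation mu := (@lebesgue_measure R).

(** Derivative within [a, b] in increment form. It covers one-sided derivatives at
the end points and is stable under sums without any division. *)
Definition tangent a b F t m := forall eta, 0 < eta -> exists2 r, 0 < r &
  forall y, a <= y <= b -> `|y - t| < r ->
    `|F y - F t - m * (y - t)| <= eta * `|y - t|.

Lemma tangentD a b F G t m p : tangent a b F t m -> tangent a b G t p ->
  tangent a b (fun x => F x + G x) t (m + p).
Proof.
move=> tF tG eta eta0; have eta2 : 0 < eta / 2 by rewrite divr_gt0.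
have [r r0 Hr] := tF _ eta2; have [q q0 Hq] := tG _ eta2.
exists (Num.min r q); first by rewrite lt_min r0.
move=> y yab; rewrite lt_min => /andP[/(Hr _ yab) h1 /(Hq _ yab) h2].
have -> : F y + G y - (F t + G t) - (m + p) * (y - t) =
  (F y - F t - m * (y - t)) + (G y - G t - p * (y - t)) by ring.
by apply: le_trans (ler_normD _ _) _; rewrite [leRHS](_ : _ =
  eta / 2 * `|y - t| + eta / 2 * `|y - t|) ?lerD //; field.
Qed.

Lemma tangentZ a b F t m c : tangent a b F t m ->
  tangent a b (fun x => c * F x) t (c * m).
Proof.
move=> tF eta eta0; have c0 : 0 < `|c| + 1 by rewrite ltr_wpDl.
have [r r0 Hr] := tF _ (divr_gt0 eta0 c0).
exists r => // y yab /(Hr _ yab) h.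
have -> : c * F y - c * F t - c * m * (y - t) = c * (F y - F t - m * (y - t)) by ring.
rewrite normrM; apply: le_trans (ler_wpM2l (normr_ge0 _) h) _.
rewrite mulrA ler_wpM2r // mulrA ler_pdivrMr // mulrC ler_wpM2l ?(ltW eta0) //.
by rewrite lerDl.
Qed.

Lemma tangentN a b F t m : tangent a b F t m ->
  tangent a b (fun x => - F x) t (- m).
Proof.
move=> /(@tangentZ _ _ _ _ _ (-1)); rewrite mulN1r.
by under eq_fun do rewrite mulN1r.
Qed.

Lemma tangent_lin a b t c d : tangent a b (fun x => c * x + d) t c.
Proof.
move=> eta eta0; exists 1 => // y _ _.
have -> : c * y + d - (c * t + d) - c * (y - t) = 0 by ring.
by rewrite normr0 mulr_ge0 // ltW.
Qed.

Lemma tangentS a b a' b' F t m : a <= a' -> b' <= b ->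
  tangent a b F t m -> tangent a' b' F t m.
Proof.
move=> aa bb tF eta eta0; have [r r0 Hr] := tF _ eta0.
exists r => // y /andP[ay yb]; apply: Hr.
by rewrite (le_trans aa ay) (le_trans yb bb).
Qed.

(** The supremum of the points where K is at least K a belongs to this set by
monotonicity on its left and equals b by monotonicity on its right. *)
Lemma locally_nondecreasing K a b : a <= b ->
  (forall t, a <= t <= b -> exists2 r, 0 < r & forall y, a <= y <= b ->
     `|y - t| < r -> (t <= y -> K t <= K y) /\ (y <= t -> K y <= K t)) ->
  K a <= K b.
Proof.
move=> ab locK.
pose S := [set x | a <= x <= b /\ K a <= K x].
have Sa : S a by rewrite /S /= lexx ab.
have hS : has_sup S by split; [exists a|exists b => x [/andP[]]].
pose c := sup S.
have ac : a <= c by apply: ub_le_sup => //; case: hS.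
have cb : c <= b by apply: ge_sup; [exists a|move=> x [/andP[]]].
have cab : a <= c <= b by rewrite ac.
have [r r0 Hr] := locK _ cab.
have Kc : K a <= K c.
  have [x Sx cx] := sup_adherent r0 hS.
  have xc : x <= c by apply: ub_le_sup => //; case: hS.
  case: Sx => xab Kx; apply: le_trans Kx _.
  apply: (Hr _ xab _).2 => //.
  by rewrite distrC ger0_norm ?subr_ge0 // ltrBlDr addrC -ltrBlDr.
have [<-//|cb'] := eqVneq c b.
have {cb'}cltb : c < b by rewrite lt_neqAle cb' cb.
pose y := Num.min b (c + r / 2).
have cy : c < y by rewrite lt_min cltb ltrDl divr_gt0.
have yb : y <= b by rewrite ge_min lexx.
have yab : a <= y <= b by rewrite yb (le_trans ac (ltW cy)).
suff : S y by move=> /(ub_le_sup hS.2); rewrite -/c leNgt cy.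
split => //; apply: le_trans Kc _.
apply: (Hr _ yab _).1; last exact: ltW.
rewrite gtr0_norm ?subr_gt0 // ltrBlDl.
apply: (@le_lt_trans _ _ (c + r / 2)); first by rewrite ge_min lexx orbT.
rewrite ltrD2l; lra.
Qed.

(** Where the slope is nonnegative F decreases at a rate below any eta > 0;
elsewhere its decrease is charged to the nondecreasing function V. Hence
F + eta id + V is locally nondecreasing for each eta > 0. *)
Lemma slope_ge0_nondecreasing_mod F V a b : a <= b ->
  (forall x y, a <= x -> x <= y -> y <= b -> V x <= V y) ->
  (forall t, a <= t <= b -> (exists2 m, 0 <= m & tangent a b F t m) \/
     (exists2 r, 0 < r & forall x y, a <= x -> x <= y -> y <= b ->
        `|x - t| < r -> `|y - t| < r -> F x - F y <= V y - V x)) ->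
  F a - F b <= V b - V a.
Proof.
move=> ab Vnd H; apply/ler_addgt0Pl => e e0.
(* The term 1 keeps the quotient meaningful when a = b. *)
pose eta := e / (b - a + 1).
have ba0 : 0 < b - a + 1 by rewrite ltr_wpDl // subr_ge0.
have eta0 : 0 < eta by rewrite divr_gt0.
have etae : eta * (b - a) <= e.
  rewrite /eta mulrAC ler_pdivrMr // ler_wpM2l ?(ltW e0) // lerDl //.
have : F a + eta * a + V a <= F b + eta * b + V b.
  apply: (@locally_nondecreasing (fun x => F x + eta * x + V x)) => // t tab.
  have [at_ tb] := andP tab.
  have [[m m0 tm]|[r r0 Hr]] := H t tab; last first.
    exists r => // y /andP[ay yb] yt; split=> hty.
      by have := Hr t y at_ hty yb; rewrite subrr normr0 => /(_ r0 yt); nra.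
    by have := Hr y t ay hty tb; rewrite subrr normr0 => /(_ yt r0); nra.
  have [r r0 Hr] := tm _ eta0.
  exists r => // y yab yt; have := Hr y yab yt; have [ay yb] := andP yab.
  rewrite ler_norml => /andP[h1 h2]; split => hty.
    have := Vnd _ _ at_ hty yb; move: h1 h2.
    by rewrite ger0_norm ?subr_ge0 //; nra.
  have := Vnd _ _ ay hty tb; move: h1 h2.
  by rewrite ler0_norm ?subr_le0 //; nra.
nra.
Qed.

Lemma slope_ge0_nondecreasing F a b : a <= b ->
  (forall t, a <= t <= b -> exists2 m, 0 <= m & tangent a b F t m) ->
  F a <= F b.
Proof.
move=> ab H; rewrite -subr_le0 -[leRHS](subrr 0).
by apply: (@slope_ge0_nondecreasing_mod F (cst 0)) => // t tab; left; exact: H.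
Qed.

(** One-sided absolute continuity: only the decrease of F over small sets is
controlled. Unlike the two-sided notion it is preserved by adding any
nondecreasing function. *)
Definition lower_abs_continuous F := forall e : R, 0 < e ->
  exists2 dlt : R, 0 < dlt & forall (m : nat) (a b : 'I_m -> R),
    (forall i, 0 <= a i /\ a i <= b i /\ b i <= 1) ->
    trivIset setT (fun i => `]a i, b i[%classic) ->
    \sum_i (b i - a i) < dlt -> \sum_i (F (a i) - F (b i)) < e.

Section variation.
Variables (F : R -> R) (lo : R) (U : set R).

(** A relation rather than a supremum, so that a family can be extended by one
interval; the supremum over v is the negative variation of F inside U. *)
Definition falls (x v : R) := exists m (a b : 'I_m -> R),
  [/\ forall i, lo <= a i /\ a i <= b i /\ b i <= x,
      forall i, `]a i, b i[%classic `<=` U,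
      trivIset setT (fun i => `]a i, b i[%classic) &
      v = \sum_i (F (a i) - F (b i))].

Lemma falls0 x : falls x 0.
Proof.
exists 0%N, (fun=> 0), (fun=> 0); split; try by case.
by rewrite big_ord0.
Qed.

Lemma falls_add x y v : lo <= x -> x <= y -> `]x, y[%classic `<=` U ->
  falls x v -> falls y (v + (F x - F y)).
Proof.
move=> lox xy xyU [m [a [b [ab abU tab ->]]]].
pose ext (f : 'I_m -> R) (z : R) (i : 'I_m.+1) := oapp f z (unlift ord0 i).
have extL f z i : ext f z (lift ord0 i) = f i by rewrite /ext liftK.
have ext0 f z : ext f z ord0 = z by rewrite /ext unlift_none.
exists m.+1, (ext a x), (ext b y); split.
- move=> i; have [j ->|->] := unliftP ord0 i; last by rewrite !ext0.
  by rewrite !extL; have [h1 [h2 h3]] := ab j; rewrite h1 h2 (le_trans h3).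
- by move=> i; have [j ->|->] := unliftP ord0 i; rewrite !(ext0, extL).
- move=> i j _ _ [z [/=]].
  have [i' ->|->] := unliftP ord0 i; have [j' ->|->] := unliftP ord0 j;
    rewrite !(ext0, extL) // !in_itv /= => zi zj.
  + by congr (lift _ _); apply: (tab i' j') => //; exists z; rewrite /= !in_itv.
  + have [_ [_ bx]] := ab i'; case/andP: zi => _ zb; case/andP: zj => xz _.
    by have := lt_trans xz zb; rewrite ltNge bx.
  + have [_ [_ bx]] := ab j'; case/andP: zj => _ zb; case/andP: zi => xz _.
    by have := lt_trans xz zb; rewrite ltNge bx.
- rewrite big_ord_recl !ext0 addrC; congr (_ + _).
  by apply: eq_bigr => i _; rewrite !extL.
Qed.

Lemma falls_le x y v : x <= y -> falls x v -> falls y v.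
Proof.
move=> xy [m [a [b [ab abU tab ->]]]]; exists m, a, b; split => // i.
by have [h1 [h2 h3]] := ab i; rewrite h1 h2 (le_trans h3).
Qed.

End variation.

Lemma sum_disjoint_itv_le (m : nat) (a b : 'I_m -> R) (U : set R) (c : R) :
  (forall i, a i <= b i) -> (forall i, `]a i, b i[%classic `<=` U) ->
  trivIset setT (fun i => `]a i, b i[%classic) -> measurable U ->
  (mu U <= c%:E)%E -> \sum_i (b i - a i) <= c.
Proof.
move=> ab abU tab mU Uc; rewrite -lee_fin; apply: le_trans Uc.
rewrite -sumEFin.
apply: (@le_trans _ _ (mu (\big[setU/set0]_i `]a i, b i[%classic))).
  rewrite measure_bigsetU_ord //=.
  apply: lee_sum => i _; rewrite lebesgue_measure_itv /= lte_fin.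
  have [//|] := ltP (a i) (b i).
  by move=> ba; rewrite lee_fin subr_le0.
apply: le_measure; rewrite ?inE //.
  by apply: bigsetU_measurable => i _.
apply: (big_ind (fun A => A `<=` U)) => // A B AU BU.
by rewrite subUset.
Qed.

(** The exceptional null set is covered by an open set U so small that the total
decrease of F inside U is less than e. The decrease inside U up to x is a
nondecreasing function of x, to which the decrease of F near exceptional points
can be charged, so F loses at most e. *)
Lemma ae_slope_ge0_nondecreasing F a b : 0 <= a -> a <= b -> b <= 1 ->
  lower_abs_continuous F ->
  {ae mu, forall t, a < t < b -> exists2 m, 0 <= m & tangent a b F t m} ->
  F a <= F b.
Proof.
move=> a0 ab b1 acF [N [mN N0 HN]]; apply/ler_addgt0Pl => e e0.
have [dlt dlt0 Hdlt] := acF _ e0.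
(* The slope is known on the open interval only, so the end points are
   exceptional too. *)
pose N' := N `|` [set a; b].
have mN' : measurable N' by apply: measurableU => //; exact: measurableU.
have N'0 : mu N' = 0%E.
  by apply: null_set_setU => //; [exact: measurableU|apply: null_set_setU => //;
    exact: lebesgue_measure_set1].
have [U [oU N'U Ue]] : exists U : set R, [/\ open U, N' `<=` U & (mu U < dlt%:E)%E].
  have N'fin : (mu N' < +oo)%E by rewrite N'0 ltry.
  have [U [oU NU Ue]] := lebesgue_regularity_outer mN' N'fin dlt0.
  exists U; split => //.
  have -> : mu U = (mu (U `\` N') + mu N')%E.
    by rewrite -measureU ?setDKU // ?setDKI //; apply: measurableD => //;
      exact: open_measurable.
  by rewrite N'0 adde0.
have mU : measurable U by exact: open_measurable.
have fall_lt x v : x <= b -> falls F a U x v -> v < e.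
  move=> xb [m [c [d [cd cdU tcd ->]]]]; apply: Hdlt => //.
    move=> i; have [h1 [h2 h3]] := cd i.
    by rewrite (le_trans a0 h1) h2 (le_trans h3) // (le_trans xb).
  have muUfin : mu U \is a fin_num.
    by rewrite ge0_fin_numE // (lt_trans Ue) // ltry.
  have : (fine (mu U) < dlt)%R by rewrite -lte_fin fineK.
  apply: le_lt_trans; apply: (@sum_disjoint_itv_le _ _ _ U) => //.
    by move=> i; have [_ [? _]] := cd i.
  by rewrite fineK.
pose V x := sup [set v | falls F a U x v].
have supV x : x <= b -> has_sup [set v | falls F a U x v].
  move=> xb; split; first by exists 0; exact: falls0.
  by exists e => v /(fall_lt _ _ xb)/ltW.
have Vb : V b <= e.
  by apply: ge_sup; [exists 0; exact: falls0|move=> v /fall_lt => /(_ (lexx _))/ltW].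
have Va : 0 <= V a.
  by apply: ub_le_sup; [case: (supV a ab)|exact: falls0].
have : F a - F b <= V b - V a.
  apply: slope_ge0_nondecreasing_mod => //.
    move=> x y _ xy yb; apply: ge_sup; first by exists 0; exact: falls0.
    move=> v vx; apply: ub_le_sup; first by case: (supV y yb).
    exact: falls_le vx.
  move=> t tab; have [tN|tN] := pselect (N' t); last first.
    have tab' : a < t < b.
      have [at_ tb] := andP tab; rewrite !lt_neqAle at_ tb !andbT.
      by apply/andP; split; apply/eqP => E; apply: tN; right; [left|right].
    apply: contrapT => nslope; apply: tN; left; apply: HN => /= slope.
    by apply: nslope; left; exact: slope.
  right; have /nbhs_ballP[r /= r0 rU] : nbhs t U.
    by apply: open_nbhs_nbhs; split => //; exact: N'U.
  exists r => // x y ax xy yb xr yr.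
  rewrite lerBrDl.
  have xyU : `]x, y[%classic `<=` U.
    move=> z; rewrite /= in_itv /= => /andP[xz zy]; apply: rU.
    rewrite /ball /= distrC ltr_distl; move: xr yr; rewrite !ltr_distl.
    move=> /andP[h1 h2] /andP[h3 h4]; apply/andP; split.
      exact: lt_trans xz.
    exact: lt_trans h4.
  rewrite -lerBrDr; apply: ge_sup; first by exists 0; exact: falls0.
  move=> v vx; rewrite lerBrDr; apply: ub_le_sup; first by case: (supV y yb).
  exact: falls_add vx.
by lra.
Qed.

End slopes.

(** * Taylor approximation in Sobolev spaces *)

Section energy.
Context {R : realType}.
Implicit Types (F g h : R -> R) (a b t x y : R).
Notation mu := (@lebesgue_measure R).

Lemma tangent_derivable a b F t : derivable F t 1 -> tangent a b F t (F^`() t)%classic.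
Proof.
move=> dF eta eta0.
have := dF => /cvg_ex[/= m Hm]; have mE : m = (F^`() t)%classic.
  by apply/esym; rewrite derive1E; apply: cvg_lim Hm; exact: Rhausdorff.
move/cvgrPdist_le : Hm => /(_ _ eta0); rewrite near_withinE => /nbhs_ballP[r /= r0 Hr].
exists r => // y _ yt; have [->|yt0] := eqVneq y t.
  by rewrite !subrr mulr0 subrr !normr0 mulr0.
have yt0' : y - t != 0 by rewrite subr_eq0.
have := Hr (y - t); rewrite /ball /= sub0r normrN => /(_ yt yt0').
rewrite -mE [_ *: 1]mulr1 subrK /GRing.scale /= => H.
have -> : F y - F t - m * (y - t) = - ((m - (y - t)^-1 * (F y - F t)) * (y - t)).
  by field.
by rewrite normrN normrM ler_wpM2r.
Qed.

Lemma tangent_derivable01 g t : derivable01 g t -> tangent 0 1 g t (derive01 g t).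
Proof.
move=> dg eta eta0.
have /cvgrPdist_le/(_ _ eta0) : diff_quot g t @ within I01 t^' --> derive01 g t by exact: dg.
rewrite near_withinE near_withinE => /nbhs_ballP[r /= r0 Hr].
exists r => // y y01 yt; have [->|yt0] := eqVneq y t.
  by rewrite !subrr mulr0 subrr !normr0 mulr0.
have yt0' : y - t != 0 by rewrite subr_eq0.
have := Hr y; rewrite /ball /= distrC => /(_ yt yt0).
rewrite /I01 /= in_itv /= => /(_ y01); rewrite /diff_quot => H.
have -> : g y - g t - derive01 g t * (y - t) =
    - ((derive01 g t - (g y - g t) / (y - t)) * (y - t)).
  by field.
by rewrite normrN normrM ler_wpM2r.
Qed.

(** Cutting the integrand off outside [0, 1] makes it integrable on the whole
line, as the differentiation theorem requires. *)
Definition energy h x : R := \int[mu]_(t in `[0, x]) ((fun s => h s ^+ 2) \_ I01) t.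

Section properties.
Variable h : R -> R.
Hypothesis L2h : L2_01 h.
Let f := (fun s => h s ^+ 2) \_ I01.

Let f0 t : 0 <= f t.
Proof. by rewrite /f patchE; case: ifP => // _; exact: sqr_ge0. Qed.

Let mI01 : measurable (I01 : set R).
Proof. exact: measurable_itv. Qed.

Let intf (A : set R) : measurable A -> mu.-integrable A (EFin \o f).
Proof.
move=> mA; apply: (@integrableS _ _ _ _ setT) => //.
have [_] := L2h; rewrite [X in X -> _]integrable_mkcond //.
congr (_ .-integrable _ _); apply/funext => t.
by rewrite /f /= !patchE; case: ifP.
Qed.

Lemma energy_nd x y : x <= y -> energy h x <= energy h y.
Proof.
move=> xy; rewrite /energy /Rintegral; apply: fine_le.
- by apply: integrable_fin_num => //; exact: intf.
- by apply: integrable_fin_num => //; exact: intf.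
apply: ge0_subset_integral => //.
- by case/integrableP: (intf (measurable_itv `[0, y])).
- by move=> t _; rewrite lee_fin.
- by move=> t /=; rewrite !in_itv /= => /andP[-> /le_trans]; exact.
Qed.

Lemma energy0 : energy h 0 = 0.
Proof.
by rewrite /energy set_itv1 /Rintegral integral_set1.
Qed.

Lemma energy1 : energy h 1 = \int[mu]_(t in I01) (h t ^+ 2).
Proof.
apply: eq_Rintegral => t; rewrite inE => t01.
by rewrite patchE mem_set.
Qed.

(** Lebesgue's differentiation theorem. *)
Lemma energy_tangent :
  {ae mu, forall t, 0 < t -> t < 1 -> tangent 0 1 (energy h) t (h t ^+ 2)}.
Proof.
have locf : locally_integrable setT f.
  by apply: integrable_locally => //; have [] := L2h.
have := @FTC1 R f (BLeft 0) (fun y => intf (measurable_itv _)) locf.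
apply: filterS; first exact: (ae_filter_ringOfSetsType mu).
move=> t H t0 t1.
have [|dE E] := H; first by rewrite lte_fin.
have -> : h t ^+ 2 = ((energy h)^`() t)%classic.
  rewrite [RHS]E /f patchE mem_set // /I01 /= in_itv /=.
  by rewrite !ltW.
exact: tangent_derivable.
Qed.

End properties.

(** Optimizing over s turns the arithmetic-geometric mean bound into the
Cauchy-Schwarz bound. *)
Lemma sqr_le_of_amgm (z p q : R) : 0 <= p -> 0 <= q ->
  (forall s, 0 < s -> 2 * z <= s * p + q / s) -> 0 <= z -> z ^+ 2 <= p * q.
Proof.
move=> p0 q0 H z0; have [-> |zn0] := eqVneq z 0; first by rewrite expr0n mulr_ge0.
have zp : 0 < z by rewrite lt_neqAle eq_sym zn0.
(* When p = 0 a large s is contradictory; otherwise s = z / p is optimal. *)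
have [pE|pn0] := eqVneq p 0.
  exfalso; have sp : 0 < (q + 1) / z by rewrite divr_gt0 // ltr_wpDl.
  have := H _ sp; rewrite pE mulr0 add0r invf_div mulrA ler_pdivlMr ?ltr_wpDl //.
  by nra.
have pp : 0 < p by rewrite lt_neqAle eq_sym pn0.
have := H _ (divr_gt0 zp pp); rewrite divfK // invf_div mulrA.
have : q * p / z * z = q * p by rewrite divfK.
by nra.
Qed.

(** Fundamental theorem of calculus combined with Cauchy-Schwarz. Since
2 |g'| <= s + g'^2 / s, the function s x + (energy up to x) / s has an almost
everywhere larger slope than 2 g and than - 2 g, hence larger increments. *)
Lemma sqr_increment_le g a b : 0 <= a -> a <= b -> b <= 1 ->
  abs_continuous01 g ->
  {ae mu, forall t, I01 t -> derivable01 g t} ->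
  L2_01 (derive01 g) ->
  (g b - g a) ^+ 2 <= (b - a) * (energy (derive01 g) b - energy (derive01 g) a).
Proof.
move=> a0 ab b1 acg dg L2g; pose E := energy (derive01 g).
suff key (c : R) : c ^+ 2 = 1 -> forall s, 0 < s ->
    2 * (c * (g b - g a)) <= s * (b - a) + (E b - E a) / s.
  rewrite -real_normK ?num_real //; apply: sqr_le_of_amgm => //.
  - by rewrite subr_ge0.
  - by rewrite subr_ge0 energy_nd.
  - move=> s s0; have [h|h] := leP 0 (g b - g a).
      by have := key 1 (expr1n _ _) s s0; rewrite mul1r ger0_norm.
    have n1 : (-1) ^+ 2 = 1 :> R by rewrite sqrrN expr1n.
    by have := key _ n1 s s0; rewrite mulN1r ltr0_norm.
move=> c2 s s0.
pose F x := (2 ^-1 * s) * x + 0 + ((2 * s)^-1 * E x + - c * g x).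
suff : F a <= F b.
  rewrite /F => H.
  have -> : (E b - E a) / s = 2 * ((2 * s)^-1 * E b - (2 * s)^-1 * E a).
    by field; rewrite gt_eqF.
  by lra.
apply: ae_slope_ge0_nondecreasing => //.
  move=> e e0; have [dlt dlt0 Hd] := acg _ e0; exists dlt => // m u v uv tuv Huv.
  apply: le_lt_trans (Hd _ _ _ uv tuv Huv); apply: ler_sum => i _.
  have [u0 [uvi v1]] := uv i.
  have EE : E (u i) <= E (v i) by exact: energy_nd.
  have : (2 * s)^-1 * E (u i) <= (2 * s)^-1 * E (v i).
    by rewrite ler_wpM2l // invr_ge0 mulr_ge0 // ltW.
  have : c * (g (v i) - g (u i)) <= `|g (v i) - g (u i)|.
    apply: le_trans (ler_norm _) _; rewrite normrM.
    have -> : `|c| = 1; last by rewrite mul1r.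
    by apply/eqP; rewrite -sqrp_eq1 // real_normK ?num_real // c2.
  have : 2 ^-1 * s * u i <= 2 ^-1 * s * v i.
    by rewrite ler_wpM2l // mulr_ge0 // ltW.
  by rewrite /F; lra.
have := energy_tangent L2g; move: dg.
apply: filterS2; first exact: (ae_filter_ringOfSetsType mu).
move=> t dg Et /andP[at_ tb].
have t0 : 0 < t by exact: le_lt_trans at_.
have t1 : t < 1 by exact: lt_le_trans b1.
have t01 : I01 t by rewrite /I01 /= in_itv /= !ltW.
have {}dg := dg t01.
exists (2 ^-1 * s + ((2 * s)^-1 * derive01 g t ^+ 2 + - c * derive01 g t)).
  have -> : 2 ^-1 * s + ((2 * s)^-1 * derive01 g t ^+ 2 + - c * derive01 g t) =
    (2 * s)^-1 * (derive01 g t - c * s) ^+ 2 + (1 - c ^+ 2) * s / 2.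
    by field; rewrite gt_eqF.
  by rewrite c2 subrr !mul0r addr0 mulr_ge0 ?sqr_ge0 // invr_ge0 mulr_ge0 // ltW.
apply: (tangentS a0 b1).
apply: tangentD; first exact: tangent_lin.
by apply: tangentD; apply: tangentZ; [exact: Et|exact/tangent_derivable01/dg].
Qed.

End energy.

Section taylor.
Context {R : realType}.
Implicit Types (g : R -> R) (p : {poly R}) (a b t : R).

Definition antideriv p : {poly R} := \poly_(i < (size p).+1) (p`_i.-1 / i%:R).

Lemma deriv_antideriv p : (antideriv p)^`() = p.
Proof.
apply/polyP => i; rewrite coef_deriv coef_poly ltnS.
have [ip|ip] := ltnP i (size p).
  by rewrite /= -[LHS]mulr_natr divfK // pnatr_eq0.
by rewrite mul0rn nth_default.
Qed.

Lemma tangent_horner a b p t : tangent a b (fun x => p.[x]) t p^`().[t].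
Proof.
have -> : p^`().[t] = ((horner p)^`() t)%classic by rewrite -derivE.
by apply: tangent_derivable; exact: derivable_horner.
Qed.

Lemma sobolev_derive01 l g : sobolev l.+2 g ->
  [/\ forall t, I01 t -> derivable01 g t & sobolev l.+1 (derive01 g)].
Proof.
move=> [dg acg aeg L2g].
have E k : derive01n k (derive01 g) = derive01n k.+1 g by rewrite /derive01n iterSr.
split; first by move=> t; exact: (dg 0%N).
split.
- by move=> k t kl t01; rewrite E; exact: dg.
- by move=> k kl; rewrite E; exact: acg.
- by rewrite /= E.
- by rewrite E.
Qed.

Lemma sobolev_energy_nd l g x y : sobolev l g -> x <= y ->
  energy (derive01n l g) x <= energy (derive01n l g) y.
Proof. by case=> _ _ _ L2g; exact: energy_nd. Qed.

(** Mean value inequality, from the monotonicity of B x + F and of B x - F. *)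
Lemma slope_le_increment (F : R -> R) a t (B : R) : a <= t ->
  (forall x, a <= x <= t -> exists2 m, `|m| <= B & tangent a t F x m) ->
  `|F t - F a| <= B * (t - a).
Proof.
move=> at_ H; rewrite ler_norml; apply/andP; split.
  suff : B * a + 0 + F a <= B * t + 0 + F t by lra.
  apply: (@slope_ge0_nondecreasing _ (fun x => B * x + 0 + F x)) => // x xat.
  have [m] := H x xat; rewrite ler_norml => /andP[m1 m2] tm.
  exists (B + m); first by lra.
  by apply: tangentD => //; exact: tangent_lin.
suff : B * a + 0 + - F a <= B * t + 0 + - F t by lra.
apply: (@slope_ge0_nondecreasing _ (fun x => B * x + 0 + - F x)) => // x xat.
have [m] := H x xat; rewrite ler_norml => /andP[m1 m2] tm.
exists (B + - m); first by lra.
by apply: tangentD; [exact: tangent_lin|exact: tangentN].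
Qed.

(** Taylor expansion at the left end. The polynomial for g is an antiderivative of
the polynomial for g', so each integration gains a factor b - a over the case
l = 1. *)
Lemma sobolev_taylor l g a b : sobolev l.+1 g -> 0 <= a -> a <= b -> b <= 1 ->
  exists p, [/\ (size p <= l.+1)%N, p.[a] = g a &
    forall t, a <= t <= b -> (g t - p.[t]) ^+ 2 <=
      (b - a) ^+ (2 * l).+1 *
      (energy (derive01n l.+1 g) b - energy (derive01n l.+1 g) a)].
Proof.
elim: l g => [|l IH] g sg a0 ab b1.
  have [_ acg aeg L2g] := sg.
  exists (g a)%:P; split; [exact: size_polyC_leq1|by rewrite hornerC|].
  move=> t /andP[at_ tb]; rewrite hornerC muln0 expr1.
  apply: le_trans (sqr_increment_le a0 at_ (le_trans tb b1) (acg 0%N isT) aeg L2g) _.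
  have nd1 := energy_nd L2g at_; have nd2 := energy_nd L2g tb.
  by apply: ler_pM; rewrite ?subr_ge0 // lerD2r.
have [dg sg'] := sobolev_derive01 sg.
have [p [sp _ Hp]] := IH _ sg' a0 ab b1.
have E : derive01n l.+1 (derive01 g) = derive01n l.+2 g by rewrite /derive01n [RHS]iterSr.
rewrite E in Hp.
set W := energy (derive01n l.+2 g) b - energy (derive01n l.+2 g) a in Hp *.
have W0 : 0 <= W by rewrite subr_ge0; exact: sobolev_energy_nd.
have ba0 : 0 <= b - a by rewrite subr_ge0.
(* The constant of integration makes P and g agree at a. *)
pose q := antideriv p; pose P := q + (g a - q.[a])%:P.
have dP : P^`() = p by rewrite derivD derivC addr0 deriv_antideriv.
exists P; split.
- apply: leq_trans (size_polyD _ _) _; rewrite geq_max; apply/andP; split.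
    by apply: leq_trans (size_poly _ _) _.
  exact: leq_trans (size_polyC_leq1 _) _.
- by rewrite hornerD hornerC; ring.
move=> t /andP[at_ tb]; pose B := Num.sqrt ((b - a) ^+ (2 * l).+1 * W).
have B0 : 0 <= B by exact: sqrtr_ge0.
have B2 : B ^+ 2 = (b - a) ^+ (2 * l).+1 * W.
  by rewrite sqr_sqrtr // mulr_ge0 // exprn_ge0.
have : `|(g t - P.[t]) - (g a - P.[a])| <= B * (t - a).
  apply: (@slope_le_increment (fun x => g x - P.[x])) => // x /andP[ax xt].
  exists (derive01 g x - p.[x]).
    rewrite -ler_sqr ?nnegrE // real_normK ?num_real // B2.
    by apply: Hp; rewrite ax (le_trans xt tb).
  apply: tangentD.
    apply: (tangentS a0 (le_trans tb b1)).
    apply: tangent_derivable01; apply: dg.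
    by rewrite /I01 /= in_itv /= (le_trans a0 ax) (le_trans xt) // (le_trans tb).
  by apply: tangentN; rewrite -dP; exact: tangent_horner.
have -> : g a - P.[a] = 0 by rewrite hornerD hornerC; ring.
rewrite subr0 => h.
rewrite -real_normK ?num_real //.
apply: (@le_trans _ _ ((B * (b - a)) ^+ 2)).
  rewrite lerXn2r ?nnegrE ?mulr_ge0 //.
  by apply: le_trans h _; rewrite ler_wpM2l // lerD2r.
rewrite exprMn B2 (_ : (2 * l.+1).+1 = 2 + (2 * l).+1)%N; last by rewrite mulnS.
by rewrite exprD le_eqVlt; apply/orP; left; apply/eqP; ring.
Qed.

End taylor.

(** * Approximation of additive functions on a design *)

Section partition.
Context {R : realType}.

(** Ties between design points are broken arbitrarily, so that every point has a
rank of its own. *)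
Lemma sorting_rank (n : nat) (t : 'I_n -> R) : exists r : 'I_n -> nat,
  [/\ injective r, forall i, (r i < n)%N &
      forall i j, (r i <= r j)%N -> t i <= t j].
Proof.
pose leT i j := t i <= t j; pose s := sort leT (enum 'I_n).
have mem_s i : i \in s by rewrite mem_sort mem_enum.
have size_s : size s = n by rewrite size_sort size_enum_ord.
exists (index^~ s); split.
- by move=> i j; apply: index_inj.
- by move=> i; rewrite -[X in (_ < X)%N]size_s index_mem.
- have leTr : transitive leT by move=> x y z; exact: le_trans.
  have leTrefl : reflexive leT by move=> x; exact: lexx.
  have s_sorted : sorted leT s by apply: sort_sorted => x y; exact: le_total.
  by move=> i j; apply: (sorted_leq_index leTr leTrefl s_sorted).
Qed.

Lemma card_rank_window (n : nat) (r : 'I_n -> nat) (A : {pred 'I_n}) (k : nat) (c : R) :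
  injective r -> 0 <= c -> (forall i, i \in A -> (k < r i)%N /\ (r i)%:R < k%:R + c) ->
  #|A|%:R <= c.
Proof.
move=> rI c0 H; apply: (@le_trans _ _ (Num.truncn c)%:R); last by rewrite truncn_le.
rewrite ler_nat cardE -(size_map r) -(size_iota k.+1 (Num.truncn c)).
apply: uniq_leq_size; first by rewrite map_inj_uniq ?enum_uniq.
move=> x /mapP[i]; rewrite mem_enum => /H[ki rc] ->.
rewrite mem_iota ki /= addSn ltnS -leq_subLR truncn_ge_nat //.
by rewrite natrB ?(ltnW ki) // lerBlDl ltW.
Qed.

Section cells.
Variables (n : nat) (t : 'I_n -> R) (N l : nat).
Hypothesis t01 : forall i, 0 <= t i <= 1.
Hypothesis N0 : (0 < N)%N.

Let NR : 0 < N%:R :> R. Proof. by rewrite ltr0n. Qed.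

(** A cell is a level set of the integer part of N (t_i + r_i / n), with r_i the
rank of t_i. Both summands increase with the rank, so each of t_i and r_i / n
varies by less than 1 / N inside a cell, which equal cells and equiprobable cells
achieve only separately, and there are at most 2 N + 1 cells. Expanding
at the first point of each cell makes the error vanish there, and at most n / N
other points have a squared error of at most N^-(2 l + 1) times the energy of the
cell.
The energies of disjoint cells add up to at most the total energy. *)
Lemma piecewise_taylor : exists2 U : {vspace 'rV[R]_n},
  (\dim U <= (2 * N).+1 * l.+1)%N &
  forall g, sobolev l.+1 g -> exists2 h : 'rV[R]_n, h \in U &
    \sum_i (g (t i) - h ord0 i) ^+ 2 <=
    n%:R / N%:R ^+ (2 * l.+1) * energy (derive01n l.+1 g) 1.
Proof.
have [r [rI rn rt]] := sorting_rank t.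
pose M := (2 * N).+1.
pose pos i : R := N%:R * (t i + (r i)%:R / n%:R).
have n0 (i : 'I_n) : 0 < n%:R :> R by rewrite ltr0n (leq_ltn_trans _ (ltn_ord i)).
have pos0 i : 0 <= pos i.
  by have /andP[? _] := t01 i; rewrite mulr_ge0 ?addr_ge0 ?divr_ge0.
have posM i : (Num.truncn (pos i) < M)%N.
  rewrite ltnS truncn_le_nat; apply: (@lt_trans _ _ (2 * N)%:R); last first.
    by rewrite ltr_nat.
  rewrite natrM (mulrC 2%:R) /pos ltr_pM2l //; have /andP[_ t1] := t01 i.
  have : (r i)%:R / n%:R < 1 :> R by rewrite (ltr_pdivrMr _ _ (n0 i)) mul1r ltr_nat.
  by clear n0; lra.
pose cell i : 'I_M := Ordinal (posM i).
have pos_mono i j : (r i <= r j)%N -> pos i <= pos j.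
  move=> rij; rewrite ler_wpM2l // lerD ?rt // ler_wpM2r ?invr_ge0 //.
  by rewrite ler_nat.
have cell_rank i j : (cell i < cell j)%N -> (r i < r j)%N.
  rewrite !ltnNge; apply: contraNN => /pos_mono; exact: le_truncn.
have cell_close i j : cell i = cell j -> pos j < pos i + 1.
  move=> /(congr1 val) /= cij; apply: lt_le_trans (truncnS_gt (pos j)) _.
  by rewrite -natr1 lerD2r -cij truncn_le.
(* The right end of the cells before the m-th one; gaps between cells are
   skipped, and the values telescope. *)
pose gam m : R := \big[Num.max/0]_(j | (cell j < m)%N) t j.
have gam_ge i m : (cell i < m)%N -> t i <= gam m.
  by move=> im; rewrite /gam (bigD1 i) //= le_max lexx.
have gam_le m c : 0 <= c -> (forall j, (cell j < m)%N -> t j <= c) -> gam m <= c.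
  move=> c0 H; rewrite /gam; elim/big_ind : _ => // x y xc yc.
  by rewrite ge_max xc.
have gam_ge0 m : 0 <= gam m.
  rewrite /gam; elim/big_ind : _ => // [x y x0 y0|i _]; first by rewrite le_max x0.
  by case/andP: (t01 i).
have gam0 : gam 0%N = 0 by rewrite /gam big_pred0.
pose basisv m k : 'rV[R]_n := \row_i ((cell i == m)%:R * t i ^+ k).
pose U := <<[seq basisv m k | m <- enum 'I_M, k <- iota 0 l.+1]>>%VS.
exists U.
  apply: leq_trans (dim_span _) _.
  by rewrite size_allpairs size_enum_ord size_iota.
move=> g sg; pose E := energy (derive01n l.+1 g).
have End x y : x <= y -> E x <= E y by exact: sobolev_energy_nd.
have /choice[p Hp] : forall m : 'I_M, exists p : {poly R}, (size p <= l.+1)%N /\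
    \sum_(i | cell i == m) (g (t i) - p.[t i]) ^+ 2 <=
    (n%:R / N%:R ^+ (2 * l.+1)) * (E (gam m.+1) - E (gam m)).
  move=> m; have [i0 ci0|none] := pickP (fun i => cell i == m); last first.
    exists 0; split; first by rewrite size_poly0.
    rewrite big_pred0 // mulr_ge0 ?divr_ge0 ?exprn_ge0 // subr_ge0 End //.
    apply: gam_le => //.
    by move=> j jm; apply: gam_ge; exact: leq_trans jm _.
  case: (@arg_minnP _ i0 (fun i => cell i == m) r ci0) => a /eqP ca amin.
  have ta01 := t01 a; have [ta0 ta1] := andP ta01.
  have gam_a : gam m <= t a.
    by apply: gam_le => // j; rewrite -{1}ca => /cell_rank/ltnW/rt.
  have a_gam : t a <= gam m.+1 by apply: gam_ge; rewrite ca.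
  (* Either j comes before a, or it lies in the cell of a. *)
  have close j : (cell j <= m)%N -> t j - t a <= N%:R^-1.
    move=> jm; have [rja|raj] := leqP (r j) (r a).
      by apply: (@le_trans _ _ 0); [rewrite subr_le0 rt|rewrite invr_ge0].
    have caj : cell a = cell j.
      have jm' : (cell j <= cell a)%N by rewrite ca.
      by apply/val_inj/eqP; rewrite eqn_leq jm' andbT; apply/le_truncn/pos_mono/ltnW.
    have := cell_close _ _ caj; rewrite /pos !mulrDr => h.
    have : N%:R * ((r a)%:R / n%:R) <= N%:R * ((r j)%:R / n%:R) :> R.
      by rewrite ler_wpM2l // ler_wpM2r ?invr_ge0 // ler_nat ltnW.
    move=> h2; rewrite -(ler_pM2l NR) mulfV ?gt_eqF // mulrBr; clear n0; lra.
  have gam1 : gam m.+1 <= 1 by apply: gam_le => // j _; case/andP: (t01 j).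
  have gamN : gam m.+1 - t a <= N%:R^-1.
    rewrite lerBlDr; apply: gam_le; first by rewrite addr_ge0 // invr_ge0.
    by move=> j; rewrite ltnS => /close; rewrite lerBlDr.
  have [p [sp pa Hp]] := sobolev_taylor sg ta0 a_gam gam1.
  exists p; split => //.
  rewrite (bigD1 a) ?ca //= pa subrr expr0n add0r.
  have Wle : E (gam m.+1) - E (t a) <= E (gam m.+1) - E (gam m).
    by rewrite lerD2l lerN2 End.
  have W0 : 0 <= E (gam m.+1) - E (t a) by rewrite subr_ge0 End.
  pose W := N%:R^-1 ^+ (2 * l).+1 * (E (gam m.+1) - E (gam m)).
  have W00 : 0 <= W.
    by rewrite mulr_ge0 // ?exprn_ge0 ?invr_ge0 //; apply: le_trans Wle.
  apply: (@le_trans _ _ (\sum_(i | (cell i == m) && (i != a)) W)).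
    apply: ler_sum => i /andP[/eqP ci ia].
    have tai : t a <= t i by apply: rt; apply: amin; rewrite ci.
    have tig : t i <= gam m.+1 by apply: gam_ge; rewrite ci.
    apply: le_trans (Hp _ _) _; first by rewrite tai.
    apply: ler_pM => //; first by rewrite exprn_ge0 // subr_ge0.
    by rewrite lerXn2r // nnegrE ?subr_ge0 // invr_ge0.
  rewrite sumr_const -[leLHS]mulr_natl.
  have cardle : #|[pred i | (cell i == m) && (i != a)]|%:R <= n%:R / N%:R :> R.
    apply: (@card_rank_window _ r _ (r a)) => //.
    move=> i; rewrite inE /= => /andP[/eqP ci ia].
    have rai : (r a < r i)%N.
      rewrite ltn_neqAle amin ?ci // andbT; apply: contraNneq ia => /rI ->.
      by [].
    split => //; have cai : cell a = cell i by rewrite ca ci.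
    have := cell_close _ _ cai; rewrite /pos !mulrDr => h.
    have : N%:R * t a <= N%:R * t i by rewrite ler_wpM2l // rt // ltnW.
    have nn := n0 a => ht.
    have : N%:R * ((r i)%:R / n%:R) < N%:R * ((r a)%:R / n%:R) + 1 :> R.
      by clear n0; lra.
    rewrite -(ltr_pM2l (divr_gt0 nn NR)) mulrDr mulr1.
    have E1 k : n%:R / N%:R * (N%:R * (k%:R / n%:R)) = k%:R :> R.
      by field; rewrite !gt_eqF.
    by rewrite !E1.
  apply: (@le_trans _ _ (n%:R / N%:R * W)); first by rewrite ler_wpM2r.
  rewrite /W mulrA ler_wpM2r //; first exact: le_trans Wle.
  have -> : (2 * l.+1 = (2 * l).+2)%N by rewrite mulnS.
  by rewrite exprVn (exprS _ (2 * l).+1) invfM mulrA.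
exists (\row_i (p (cell i)).[t i]).
  have -> : \row_i (p (cell i)).[t i] =
      \sum_m \sum_(k < l.+1) (p m)`_k *: basisv m k.
    apply/rowP => i; rewrite mxE summxE (bigD1 (cell i)) //= [X in _ + X]big1.
      rewrite addr0 summxE (horner_coef_wide _ (Hp (cell i)).1).
      by apply: eq_bigr => k _; rewrite !mxE eqxx mul1r.
    move=> m mi; rewrite summxE big1 // => k _; rewrite !mxE eq_sym (negPf mi).
    by rewrite mul0r mulr0.
  apply: rpred_sum => m _; apply: rpred_sum => k _; apply: rpredZ.
  apply: memv_span; apply: allpairs_f; first by rewrite mem_enum.
  by rewrite mem_iota ltn_ord.
rewrite (partition_big cell xpredT) //=.
apply: (@le_trans _ _ (\sum_(m < M) n%:R / N%:R ^+ (2 * l.+1) *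
    (E (gam m.+1) - E (gam m)))).
  apply: ler_sum => m _; apply: le_trans (Hp m).2.
  rewrite le_eqVlt; apply/orP; left; apply/eqP/eq_bigr => i /eqP ci.
  by rewrite mxE ci.
rewrite -mulr_sumr ler_wpM2l ?divr_ge0 ?exprn_ge0 //.
rewrite -(big_mkord xpredT (fun m => E (gam m.+1) - E (gam m))) telescope_sumr //.
rewrite gam0 [E 0]energy0 subr0; apply: End; apply: gam_le => // j _.
by case/andP: (t01 j).
Qed.

End cells.
End partition.

Section cosso_approx.
Context {R : realType}.

Lemma sobolev_norm_ge0 l (g : R -> R) : 0 <= sobolev_norm l g.
Proof. exact: sqrtr_ge0. Qed.

Lemma cosso_penalty_ge0 d l (f : 'rV[R]_d -> R) : 0 <= cosso_penalty l f.
Proof. by apply: sumr_ge0 => j _; exact: sobolev_norm_ge0. Qed.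

Lemma energy_le_sobolev_norm l (g : R -> R) : sobolev l g ->
  energy (derive01n l g) 1 <= sobolev_norm l g ^+ 2.
Proof.
move=> [_ _ _ L2g]; rewrite energy1 // sqr_sqrtr.
  by rewrite lerDr; apply: sumr_ge0 => k _; exact: sqr_ge0.
apply: addr_ge0; first by apply: sumr_ge0 => k _; exact: sqr_ge0.
by rewrite -energy1 // -(energy0 (derive01n l g)); exact: energy_nd.
Qed.

Lemma cosso_decomposition d l (f : 'rV[R]_d -> R) : cosso_space l f ->
  exists b : R, forall x, unit_cube x ->
    f x = b + \sum_j component l j f (x ord0 j).
Proof.
by move=> /getPex[_ fE]; exists (get (additive_decomposition l f)).1.
Qed.

Lemma component_sobolev0 d l (f : 'rV[R]_d -> R) j : cosso_space l f ->
  sobolev0 l (component l j f).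
Proof. by move=> /getPex[H _]; exact: H. Qed.

Definition evaluate n d (x : 'I_n -> 'rV[R]_d) (f : 'rV[R]_d -> R) : 'rV[R]_n :=
  \row_i f (x i).

(** Sum of one space of piecewise polynomials for each coordinate and of the
constants. *)
Lemma cosso_approximation n d l N (x : 'I_n -> 'rV[R]_d) :
  (0 < l)%N -> (0 < N)%N -> (forall i, unit_cube (x i)) ->
  exists2 U : {vspace 'rV[R]_n}, (\dim U <= (3 * d * l).+1 * N)%N &
    forall f, cosso_space l f -> exists2 h, h \in U &
      enorm (evaluate x f - h) <= Num.sqrt n%:R / N%:R ^+ l * cosso_penalty l f.
Proof.
case: l => // l _ N0 x01.
have t01 j i : 0 <= x i ord0 j <= 1 by have := x01 i; apply.
have /choice[U HU] : forall j : 'I_d, exists U : {vspace 'rV[R]_n},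
    (\dim U <= (2 * N).+1 * l.+1)%N /\
    forall g, sobolev l.+1 g -> exists2 h : 'rV[R]_n, h \in U &
    \sum_i (g (x i ord0 j) - h ord0 i) ^+ 2 <=
    n%:R / N%:R ^+ (2 * l.+1) * energy (derive01n l.+1 g) 1.
  by move=> j; have [U dimU HU] := piecewise_taylor l (t01 j) N0; exists U.
pose one : 'rV[R]_n := const_mx 1.
pose V := (<[one]> + \sum_j U j)%VS.
exists V.
  apply: leq_trans (dimv_add_leqif _ _).1 _.
  have h1 : (\dim <[one]> <= 1)%N by rewrite dim_vline leq_b1.
  have h2 : (\dim (\sum_j U j) <= d * ((2 * N).+1 * l.+1))%N.
    apply: (leq_trans (dimv_leq_sum (index_enum _) xpredT U)).
    apply: (@leq_trans (\sum_(j < d) ((2 * N).+1 * l.+1))%N).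
      by apply: leq_sum => j _; case: (HU j).
    by rewrite sum_nat_const card_ord.
  apply: leq_trans (leq_add h1 h2) _.
  rewrite [in leqRHS]mulSn; apply: leq_add => //.
  apply: (@leq_trans (d * (3 * N * l.+1))%N).
    by rewrite leq_mul2l leq_mul2r; apply/orP; right; apply/orP; right; lia.
  by rewrite leq_eqVlt; apply/orP; left; apply/eqP; nia.
move=> f ff; have [b fE] := cosso_decomposition ff.
have comp j := component_sobolev0 j ff.
have /choice[h Hh] : forall j : 'I_d, exists h : 'rV[R]_n, h \in U j /\
    enorm ((\row_i component l.+1 j f (x i ord0 j)) - h) <=
    Num.sqrt n%:R / N%:R ^+ l.+1 * sobolev_norm l.+1 (component l.+1 j f).
  move=> j; have [sj _] := comp j; have [h hU Hh] := (HU j).2 _ sj.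
  exists h; split => //.
  rewrite -ler_sqr ?nnegrE ?enorm_ge0 //; last first.
    by rewrite !mulr_ge0 ?sobolev_norm_ge0 ?sqrtr_ge0 // invr_ge0 exprn_ge0.
  rewrite sqr_enorm !exprMn sqr_sqrtr //.
  have -> : dot (\row_i component l.+1 j f (x i ord0 j) - h)
      (\row_i component l.+1 j f (x i ord0 j) - h) =
    \sum_i (component l.+1 j f (x i ord0 j) - h ord0 i) ^+ 2.
    by apply: eq_bigr => i _; rewrite !mxE expr2.
  apply: le_trans Hh _; rewrite exprVn -exprM mulnC.
  by rewrite ler_wpM2l ?divr_ge0 ?exprn_ge0 // energy_le_sobolev_norm.
exists (b *: one + \sum_j h j).
  apply: memv_add; first by rewrite memvZ // memv_line.
  by apply: memv_sumr => j _; case: (Hh j).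
have -> : evaluate x f - (b *: one + \sum_j h j) =
    \sum_j ((\row_i component l.+1 j f (x i ord0 j)) - h j).
  rewrite opprD addrA sumrB; congr (_ - _); apply/rowP => i.
  rewrite summxE !mxE fE // mulr1 [LHS]addrAC subrr add0r.
  by apply: eq_bigr => j _; rewrite mxE.
apply: le_trans (enorm_sum _ _) _.
by rewrite /cosso_penalty mulr_sumr; apply: ler_sum => j _; case: (Hh j).
Qed.

End cosso_approx.

(** * Chaining over dyadic scales *)

Section chaining.
Context {R : realType} {n : nat}.
Implicit Types e g : 'rV[R]_n.

(** The error terms decrease like (x y)^k while the noise level x^k and the
approximation error y^k of scale k vary in opposite directions, so the
telescoping sum from K on is geometric and dominated by its first term. For
K > n the bound at scale n, where h is exact, is already better. *)
Lemma chaining (S A x y : R) (h : nat -> 'rV[R]_n) e g :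
  0 <= S -> 0 <= A -> 1 <= x -> 0 <= y -> x * y <= 3 / 4 -> h n = g ->
  (forall k, (k <= n)%N -> `|dot (h k) e| <= S * x ^+ k * enorm (h k)) ->
  (forall k, (k < n)%N -> `|dot (h k.+1 - h k) e| <=
     S * x ^+ k * enorm (h k.+1 - h k)) ->
  (forall k, (k <= n)%N -> enorm (g - h k) <= A * y ^+ k) ->
  forall K, `|dot g e| <= S * (x ^+ K * enorm g + 9 * A * (x * y) ^+ K).
Proof.
move=> S0 A0 x1 y0 xy34 hng He Hd Ha.
have x0 : 0 <= x by exact: le_trans x1.
have xy0 : 0 <= x * y by exact: mulr_ge0.
have y1 : y <= 1.
  have : y <= x * y by rewrite ler_peMl.
  by move=> /le_trans -/(_ _ xy34) /le_trans; apply; lra.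
have tail k : (k <= n)%N -> `|dot (g - h k) e| <= 8 * A * S * (x * y) ^+ k.
  move=> kn; rewrite -(subKn kn); have : (n - k <= n)%N by exact: leq_subr.
  (* Downward induction from scale n, where h n = g. *)
  elim: (n - k)%N => [_|j IH jn].
    rewrite subn0 hng subrr dot0l normr0.
    by rewrite !mulr_ge0 ?exprn_ge0.
  have jn' := ltnW jn; set i := (n - j.+1)%N.
  have ij : (n - j)%N = i.+1 by rewrite /i -subSn // subSS.
  have {}IH := IH jn'; rewrite ij in IH.
  have i_lt : (i < n)%N by rewrite -ij leq_subr.
  have -> : g - h i = (h i.+1 - h i) + (g - h i.+1).
    by rewrite [RHS]addrC addrA subrK.
  rewrite dotDl; apply: le_trans (ler_normD _ _) _.
  have : enorm (h i.+1 - h i) <= 2 * A * y ^+ i.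
    have -> : h i.+1 - h i = (g - h i) - (g - h i.+1).
      by rewrite opprB [RHS]addrC addrA subrK.
    apply: le_trans (enormB _ _) _.
    have := Ha i (ltnW i_lt); have := Ha _ i_lt; rewrite exprS.
    have : A * (y * y ^+ i) <= A * y ^+ i.
      by rewrite ler_wpM2l // ler_piMl // exprn_ge0.
    by lra.
  move=> hi.
  have : `|dot (h i.+1 - h i) e| <= S * x ^+ i * (2 * A * y ^+ i).
    apply: le_trans (Hd _ i_lt) _; rewrite ler_wpM2l // mulr_ge0 ?exprn_ge0 //.
  rewrite exprS in IH.
  have : S * x ^+ i * (2 * A * y ^+ i) = 2 * A * S * (x * y) ^+ i.
    by rewrite exprMn; ring.
  move=> -> h1.
  have : 8 * A * S * (x * y * (x * y) ^+ i) <= 6 * A * S * (x * y) ^+ i.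
    have : x * y * (A * S * (x * y) ^+ i) <= 3 / 4 * (A * S * (x * y) ^+ i).
      by rewrite ler_wpM2r // !mulr_ge0 ?exprn_ge0.
    by lra.
  by lra.
move=> K; have [Kn|nK] := leqP K n; last first.
  have := He n (leqnn n); rewrite hng => /le_trans; apply.
  rewrite -mulrA ler_wpM2l // ler_wpDr ?mulr_ge0 ?exprn_ge0 //.
  by rewrite ler_wpM2r ?enorm_ge0 // ler_weXn2l // ltnW.
have -> : dot g e = dot (h K) e + dot (g - h K) e by rewrite -dotDl addrC subrK.
apply: le_trans (ler_normD _ _) _.
have h1 := tail _ Kn.
have h2 := He _ Kn.
have : enorm (h K) <= enorm g + A * y ^+ K.
  have -> : h K = g - (g - h K) by rewrite opprB addrCA subrr addr0.
  by apply: le_trans (enormB _ _) _; rewrite lerD2l Ha.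
move=> h3.
have : S * x ^+ K * enorm (h K) <= S * x ^+ K * (enorm g + A * y ^+ K).
  by rewrite ler_wpM2l // mulr_ge0 ?exprn_ge0.
have -> : S * x ^+ K * (enorm g + A * y ^+ K) =
  S * x ^+ K * enorm g + S * A * (x * y) ^+ K by rewrite exprMn; ring.
by lra.
Qed.

End chaining.

Section scale.
Context {R : realType}.

Lemma sqrt2_contraction (l : nat) : (0 < l)%N ->
  Num.sqrt 2 * 2 ^- l <= 3 / 4 :> R.
Proof.
move=> l0; apply: (@le_trans _ _ (Num.sqrt 2 / 2)).
  rewrite ler_wpM2l ?sqrtr_ge0 // lef_pV2 ?posrE ?exprn_gt0 //.
  by rewrite -[leLHS]expr1 ler_weXn2l // ler1n.
have : Num.sqrt 2 <= 3 / 2 :> R.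
  by rewrite -ler_sqr ?nnegrE ?sqrtr_ge0 ?divr_ge0 // sqr_sqrtr //; lra.
by lra.
Qed.

Definition rate (l : nat) (n : nat) (tau : R) : R :=
  Num.max (n%:R `^ (- (l%:R / (2 * l%:R - 1))) * tau `^ (- (2 / (2 * l%:R - 1))))
          (n%:R `^ (- (1 / 2))).

(** The least K that satisfies the first inequality is either 0, where the second
bound is S n^(-1/2), or such that K - 1 violates it, which bounds 2^(K/2) by a
multiple of (n^(-1/2) tau^-2)^(1/(2 l - 1)) because
(sqrt 2 2^-l)^k = (2^(k/2))^-(2 l - 1). *)
Lemma scale_choice (l : nat) (S : R) : (0 < l)%N -> 0 < S ->
  exists2 C : R, 0 < C & forall (n : nat) (tau : R), (0 < n)%N -> 0 < tau ->
    exists2 K : nat, 18 * (S / Num.sqrt n%:R) * (Num.sqrt 2 * 2 ^- l) ^+ K <= tau ^+ 2 &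
      S / Num.sqrt n%:R * Num.sqrt 2 ^+ K <= C * rate l n tau.
Proof.
move=> l0 S0; pose q : R := 2 * l%:R - 1.
have q0 : 0 < q.
  have : 1 <= l%:R :> R by rewrite ler1n.
  by rewrite /q; lra.
pose C2 := S * Num.sqrt 2 * (18 * S) `^ (q^-1).
have s2 : 0 < Num.sqrt 2 :> R by rewrite sqrtr_gt0.
have C20 : 0 < C2 by rewrite !mulr_gt0 ?powR_gt0 ?mulr_gt0.
exists (S + C2); first exact: addr_gt0.
move=> n tau n0 tau0; have nR : 0 < n%:R :> R by rewrite ltr0n.
have sn : 0 < Num.sqrt n%:R :> R by rewrite sqrtr_gt0.
pose theta : R := Num.sqrt 2 * 2 ^- l.
have theta0 : 0 < theta by rewrite mulr_gt0 ?invr_gt0 ?exprn_gt0.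
have theta1 : theta <= 3 / 4 by exact: sqrt2_contraction.
pose eta := tau ^+ 2 / (18 * (S / Num.sqrt n%:R)).
have den0 : 0 < 18 * (S / Num.sqrt n%:R) by rewrite mulr_gt0 ?divr_gt0.
have eta0 : 0 < eta by rewrite divr_gt0 ?exprn_gt0.
have exK : exists K, theta ^+ K <= eta.
  have /cvgrPdist_lt/(_ _ eta0)[K _ HK] : (fun k => theta ^+ k) @ \oo --> 0.
    by apply: cvg_expr; rewrite gtr0_norm //; lra.
  exists K; have := HK K (leqnn K); rewrite /= sub0r normrN => /ltW.
  by apply: le_trans; exact: ler_norm.
have [K HK minK] := ex_minnP exK.
exists K; first by move: HK; rewrite /eta ler_pdivlMr // mulrC.
have rate1 : n%:R `^ (- (1 / 2)) <= rate l n tau by rewrite le_max lexx orbT.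
have rate2 : n%:R `^ (- (l%:R / q)) * tau `^ (- (2 / q)) <= rate l n tau.
  by rewrite le_max lexx.
have sqn : (Num.sqrt n%:R)^-1 = n%:R `^ (- (1 / 2)) :> R.
  by rewrite powRN mul1r powR12_sqrt.
case: K => [|k] in HK minK *.
  rewrite expr0 mulr1 sqn; apply: (@le_trans _ _ (S * rate l n tau)).
    by rewrite ler_wpM2l // ltW.
  rewrite ler_wpM2r ?lerDl ?(ltW C20) //.
  by apply: le_trans rate1; exact: powR_ge0.
have etak : eta < theta ^+ k by rewrite ltNge; apply/negP => /minK; rewrite ltnn.
pose z : R := Num.sqrt 2 ^+ k; have z0 : 0 < z by exact: exprn_gt0.
have zq : z `^ q = (theta ^+ k)^-1.
  have -> : q = (2 * l - 1)%:R by rewrite natrB ?muln_gt0 // natrM.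
  rewrite powR_mulrn ?(ltW z0) // /z -exprM mulnC exprM -exprVn; congr (_ ^+ _).
  apply: (mulfI (lt0r_neq0 theta0)); rewrite mulfV ?lt0r_neq0 //.
  rewrite /theta mulrAC -exprS.
  have -> : (2 * l - 1).+1 = (2 * l)%N by rewrite subn1 prednK // muln_gt0.
  by rewrite exprM sqr_sqrtr // mulfV // expf_neq0.
have zle : z <= eta^-1 `^ q^-1.
  have -> : z = (z `^ q) `^ q^-1.
    by rewrite -powRrM mulfV ?lt0r_neq0 // powRr1 // ltW.
  rewrite zq; apply: ge0_ler_powR; rewrite ?nnegrE ?invr_ge0 ?exprn_ge0
    ?(ltW q0) ?(ltW eta0) ?(ltW theta0) //.
  by rewrite lef_pV2 ?posrE ?exprn_gt0 // ltW.
apply: (@le_trans _ _ (C2 * rate l n tau)); last first.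
  rewrite ler_wpM2r ?lerDr ?(ltW S0) //.
  by apply: le_trans rate1; exact: powR_ge0.
apply: (@le_trans _ _ (C2 * (n%:R `^ (- (l%:R / q)) * tau `^ (- (2 / q))))); last first.
  by rewrite ler_wpM2l // ltW.
have etaE : eta^-1 `^ q^-1 = (18 * S) `^ q^-1 * (n%:R `^ (- (1 / 2) * q^-1) * tau `^ (- (2 / q))).
  have -> : eta^-1 = 18 * S * (n%:R `^ (- (1 / 2)) * tau `^ (- 2%:R)).
    rewrite /eta invf_div (powRN tau) (powR_mulrn 2) ?(ltW tau0) // -sqn; ring.
  rewrite !powRM ?mulr_ge0 ?powR_ge0 ?(ltW S0) //.
  by rewrite -!powRrM !mulNr.
rewrite exprS -/z sqn.
have -> : n%:R `^ (- (l%:R / q)) = n%:R `^ (- (1 / 2)) * n%:R `^ (- (1 / 2) * q^-1) :> R.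
  rewrite -powRD; last by rewrite (gt_eqF nR) implybT.
  congr (_ `^ _).
  have -> : l%:R = (q + 1) / 2 by rewrite /q; field.
  by field; rewrite lt0r_neq0.
rewrite [leRHS](_ : _ = S * n%:R `^ (- (1 / 2)) * (Num.sqrt 2 * eta^-1 `^ q^-1)).
  by rewrite ler_wpM2l ?mulr_ge0 ?powR_ge0 ?(ltW S0) // ler_wpM2l // ltW.
by rewrite etaE /C2; ring.
Qed.

End scale.

(** * The oracle inequality *)

Section oracle.
Context {R : realType} d (T : measurableType d) (P : probability T R).

(** Scales below n use the piecewise polynomial spaces with 2^k cells. From n on,
2^k exceeds the number of design points and the whole space is used, which
makes the chain finite. A link of the chain lies in the sum of two consecutive
spaces, of dimension at most 3 D 2^k. *)
Lemma cosso_noise_bound (dim l n : nat) (x : 'I_n -> 'rV[R]_dim)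
    (X : 'I_n -> {RV P >-> R}) (s e : R) :
  (0 < l)%N -> (forall i, unit_cube (x i)) -> 0 < s -> mutually_independent X ->
  (forall i, normal_law (X i) 0 s) -> 0 < e ->
  exists2 B : set T, measurable B /\ (P B <= e%:E)%E &
    forall w, ~ B w -> forall f g, cosso_space l f -> cosso_space l g ->
    forall K, `|dot (evaluate x f - evaluate x g) (sample X w)| <=
      Num.sqrt (4 * s ^+ 2 * ((3 * (3 * dim * l).+1)%:R + 2 / e)) *
      (Num.sqrt 2 ^+ K * enorm (evaluate x f - evaluate x g) +
       9 * (Num.sqrt n%:R * (cosso_penalty l f + cosso_penalty l g)) *
       (Num.sqrt 2 * 2 ^- l) ^+ K).
Proof.
move=> l0 x01 s0 indX lawX e0.
pose D := (3 * dim * l).+1.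
have pow2 k : (0 < 2 ^ k)%N by rewrite expn_gt0.
have /choice[V0 HV0] : forall k, exists U : {vspace 'rV[R]_n},
    (\dim U <= D * 2 ^ k)%N /\
    forall f, cosso_space l f -> exists2 h, h \in U &
      enorm (evaluate x f - h) <= Num.sqrt n%:R / (2 ^ k)%:R ^+ l * cosso_penalty l f.
  by move=> k; have [U dU HU] := cosso_approximation l0 (pow2 k) x01; exists U.
pose V k := if (k < n)%N then V0 k else fullv.
have dimV k : (\dim (V k) <= D * 2 ^ k)%N.
  rewrite /V; case: ltnP => nk; first by case: (HV0 k).
  rewrite dimvf dim_matrix mul1r; apply: leq_trans (ltnW (ltn_expl n (ltnSn 1))) _.
  by apply: (@leq_trans (2 ^ k)); [rewrite leq_exp2l|rewrite leq_pmull].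
pose U k := (V k + V k.+1)%VS.
have dimU k : (\dim (U k) <= 3 * D * 2 ^ k)%N.
  apply: leq_trans (dimv_add_leqif _ _).1 _.
  apply: leq_trans (leq_add (dimV k) (dimV k.+1)) _.
  by rewrite expnS; nia.
have [B [mB PB] HB] := gaussian_dyadic_tail s0 indX lawX e0 dimU.
exists B => // w wB f g ff gg.
set S2 := 4 * s ^+ 2 * _.
have S20 : 0 <= S2.
  apply: mulr_ge0; first by rewrite mulr_ge0 ?sqr_ge0.
  by apply: addr_ge0 => //; rewrite divr_ge0 // ltW.
have noise k h : (k <= n)%N -> h \in U k ->
    `|dot h (sample X w)| <= Num.sqrt S2 * Num.sqrt 2 ^+ k * enorm h.
  move=> kn hU.
  rewrite -ler_sqr ?nnegrE ?mulr_ge0 ?exprn_ge0 ?sqrtr_ge0 // real_normK ?num_real //.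
  rewrite !exprMn sqr_enorm sqr_sqrtr // -exprM mulnC exprM sqr_sqrtr //.
  exact: HB.
have /choice[hf Hf] : forall k, exists h, h \in V0 k /\
    enorm (evaluate x f - h) <= Num.sqrt n%:R / (2 ^ k)%:R ^+ l * cosso_penalty l f.
  by move=> k; have [h hU Hh] := (HV0 k).2 _ ff; exists h.
have /choice[hg Hg] : forall k, exists h, h \in V0 k /\
    enorm (evaluate x g - h) <= Num.sqrt n%:R / (2 ^ k)%:R ^+ l * cosso_penalty l g.
  by move=> k; have [h hU Hh] := (HV0 k).2 _ gg; exists h.
pose h k := if (k < n)%N then hf k - hg k else evaluate x f - evaluate x g.
have hV k : h k \in V k.
  rewrite /h /V; case: ifP => _; last exact: memvf.
  by rewrite memvB //; [case: (Hf k)|case: (Hg k)].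
apply: (@chaining _ _ _ _ (Num.sqrt 2) (2 ^- l) h) => //.
- by rewrite mulr_ge0 ?sqrtr_ge0 ?addr_ge0 ?cosso_penalty_ge0.
- by rewrite -[leLHS]sqrtr1 ler_sqrt // ler1n.
- exact: sqrt2_contraction.
- by rewrite /h ltnn.
- move=> k kn; apply: noise => //; rewrite -[h k]addr0.
  by apply: memv_add; [exact: hV|exact: mem0v].
- move=> k kn; apply: noise; first exact: ltnW.
  by rewrite addrC; apply: memv_add; [rewrite memvN; exact: hV|exact: hV].
move=> k kn; rewrite /h; case: ifP => [_|_]; last first.
  rewrite subrr enorm0 mulr_ge0 ?exprn_ge0 ?invr_ge0 ?exprn_ge0 //.
  by rewrite mulr_ge0 ?sqrtr_ge0 ?addr_ge0 ?cosso_penalty_ge0.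
have -> : evaluate x f - evaluate x g - (hf k - hg k) =
  (evaluate x f - hf k) - (evaluate x g - hg k).
  by rewrite !opprB addrACA [RHS]addrACA; congr (_ + _); rewrite addrC.
apply: le_trans (enormB _ _) _; have := (Hf k).2; have := (Hg k).2.
rewrite natrX -exprM mulnC exprM -exprVn.
by rewrite -!exprVn; lra.
Qed.

Lemma empirical_normE (dim n : nat) (x : 'I_n -> 'rV[R]_dim) (f g : 'rV[R]_dim -> R) :
  empirical_norm x (f \- g) =
  enorm (evaluate x f - evaluate x g) / Num.sqrt n%:R.
Proof.
rewrite /empirical_norm /enorm sqrtrM ?invr_ge0 // mulrC; congr (_ * _).
  by congr Num.sqrt; apply: eq_bigr => i _; rewrite !mxE expr2.
by rewrite sqrtrV.
Qed.

(** The objective at f is at most the objective at f0; the squared noise cancels. *)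
Lemma cosso_basic_inequality (dim l n : nat) (x : 'I_n -> 'rV[R]_dim)
    (X : 'I_n -> {RV P >-> R}) (w : T) (tau : R) (f0 f : 'rV[R]_dim -> R) :
  cosso_space l f0 ->
  is_cosso_estimate l x (fun i => f0 (x i) + X i w) tau f ->
  n%:R^-1 * enorm (evaluate x f - evaluate x f0) ^+ 2 + tau ^+ 2 * cosso_penalty l f <=
  2 * (n%:R^-1 * dot (evaluate x f - evaluate x f0) (sample X w)) +
  tau ^+ 2 * cosso_penalty l f0.
Proof.
move=> ff0 [ff /(_ _ ff0)]; rewrite /cosso_objective.
set g := evaluate x f - evaluate x f0; set eps := sample X w.
have -> : \sum_i (f0 (x i) + X i w - f (x i)) ^+ 2 =
    dot eps eps - 2 * dot g eps + dot g g.
  rewrite /dot mulr_sumr -sumrB -big_split /=; apply: eq_bigr => i _.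
  by rewrite !mxE; ring.
have -> : \sum_i (f0 (x i) + X i w - f0 (x i)) ^+ 2 = dot eps eps.
  by apply: eq_bigr => i _; rewrite !mxE; ring.
by rewrite sqr_enorm; lra.
Qed.

Lemma quadratic_bound (a u v : R) : 0 <= u -> 0 <= v ->
  a ^+ 2 <= 2 * u * a + v ^+ 2 -> a <= 2 * u + v.
Proof. by move=> u0 v0 H; rewrite leNgt; apply/negP => h; nra. Qed.

(** With K from [scale_choice] the penalty part of the noise bound is at most
tau^2 (J(f) + J(f0)), which absorbs the penalty of f and leaves a quadratic
inequality for the empirical norm. The constant does not depend on tau, and the
exceptional event is chosen before tau and f, so both may be random. *)
Lemma cosso_oracle (dim l : nat) (f0 : 'rV[R]_dim -> R) (s e : R) :
  (0 < l)%N -> cosso_space l f0 -> 0 < s -> 0 < e ->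
  exists2 C : R, 0 < C &
  forall (n : nat) (x : 'I_n -> 'rV[R]_dim) (X : 'I_n -> {RV P >-> R}),
  (0 < n)%N -> (forall i, unit_cube (x i)) -> mutually_independent X ->
  (forall i, normal_law (X i) 0 s) ->
  exists2 B : set T, measurable B /\ (P B <= e%:E)%E &
  forall w tau f, ~ B w -> 0 < tau ->
    is_cosso_estimate l x (fun i => f0 (x i) + X i w) tau f ->
    empirical_norm x (f \- f0) <=
    C * (rate l n tau + tau * Num.sqrt (cosso_penalty l f0)).
Proof.
move=> l0 ff0 s0 e0.
pose S := Num.sqrt (4 * s ^+ 2 * ((3 * (3 * dim * l).+1)%:R + 2 / e)).
have S0 : 0 < S.
  rewrite sqrtr_gt0 !mulr_gt0 // ?exprn_gt0 // addr_gt0 // ?divr_gt0 //.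
have [C C0 HC] := scale_choice l0 S0.
exists (2 * C + 2); first by rewrite addr_gt0 // mulr_gt0.
move=> n x X n0 x01 indX lawX.
have [B [mB PB] HB] := cosso_noise_bound l0 x01 s0 indX lawX e0.
exists B => // w tau f wB tau0 est.
have ff := est.1.
have [K HK1 HK2] := HC n tau n0 tau0.
have := cosso_basic_inequality ff0 est.
have := HB w wB f f0 ff ff0 K; rewrite -/S.
set g := evaluate x f - evaluate x f0; set th := (_ * 2 ^- l) ^+ K in HK1 *.
set xK := Num.sqrt 2 ^+ K in HK2 *.
have Jf := cosso_penalty_ge0 l f; have Jf0 := cosso_penalty_ge0 l f0.
set J := cosso_penalty l f in Jf *; set J0 := cosso_penalty l f0 in Jf0 *.
move=> noise basic.
have nR : 0 < n%:R :> R by rewrite ltr0n.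
pose r := Num.sqrt (n%:R : R); have r0 : 0 < r by rewrite sqrtr_gt0.
have r2 : n%:R = r ^+ 2 :> R by rewrite sqr_sqrtr // ltW.
rewrite empirical_normE -/g -/r; set a := enorm g / r.
have gE : enorm g = a * r by rewrite /a divfK // gt_eqF.
have a0 : 0 <= a by rewrite divr_ge0 ?enorm_ge0 // ltW.
have rate0 : 0 <= rate l n tau by rewrite le_max powR_ge0 orbT.
have noise' : n%:R^-1 * dot g (sample X w) <= S / r * xK * a + 9 * (S / r) * th * (J + J0).
  have : n%:R^-1 * dot g (sample X w) <= n%:R^-1 * (S * (xK * enorm g + 9 * (r * (J + J0)) * th)).
    by rewrite ler_wpM2l ?invr_ge0 ?(ltW nR) //; apply: le_trans (ler_norm _) noise.
  move/le_trans; apply; rewrite le_eqVlt; apply/orP; left; apply/eqP.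
  by rewrite gE r2; field; rewrite gt_eqF.
have ga : n%:R^-1 * enorm g ^+ 2 = a ^+ 2.
  by rewrite gE r2; field; rewrite gt_eqF.
rewrite ga in basic.
have th1 : 18 * (S / r) * th * (J + J0) <= tau ^+ 2 * (J + J0).
  by rewrite ler_wpM2r // addr_ge0.
have quad : a ^+ 2 <= 2 * (S / r * xK) * a + (Num.sqrt 2 * (tau * Num.sqrt J0)) ^+ 2.
  have -> : (Num.sqrt 2 * (tau * Num.sqrt J0)) ^+ 2 = 2 * (tau ^+ 2 * J0).
    by rewrite !exprMn !sqr_sqrtr.
  by lra.
have u0 : 0 <= S / r * xK.
  by rewrite mulr_ge0 ?divr_ge0 ?exprn_ge0 ?sqrtr_ge0 // ltW.
have v0 : 0 <= tau * Num.sqrt J0 by rewrite mulr_ge0 ?sqrtr_ge0 // ltW.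
have := quadratic_bound u0 (mulr_ge0 (sqrtr_ge0 _) v0) quad.
have s22 : Num.sqrt 2 <= 2 :> R.
  by rewrite -ler_sqr ?nnegrE ?sqrtr_ge0 // sqr_sqrtr //; lra.
have : Num.sqrt 2 * (tau * Num.sqrt J0) <= 2 * (tau * Num.sqrt J0) by rewrite ler_wpM2r.
have : 0 <= C * (tau * Num.sqrt J0) by rewrite mulr_ge0 // ltW.
by lra.
Qed.

End oracle.

(** * Convergence rates *)

Section constants.
Context {R : realType}.
Notation mu := (@lebesgue_measure R).

Lemma within_I01_proper (t : R) : I01 t -> ProperFilter (within I01 t^').
Proof.
rewrite /I01 /= in_itv /= => /andP[t0 t1].
suff near_ex A : within I01 t^' A -> exists s, A s.
  by apply: (Build_ProperFilter_ex near_ex).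
move=> tA; have : nbhs t (fun s => s != t -> I01 s -> A s) by exact: tA.
move=> /nbhs_ballP[r /= r0 Hr].
pose e := Num.min r 1 / 2.
have m0 : 0 < Num.min r 1 by rewrite lt_min r0 ltr01.
have e0 : 0 < e by rewrite divr_gt0.
have er : e < r.
  by apply: (@lt_le_trans _ _ (Num.min r 1)); rewrite ?ge_min ?lexx // /e; lra.
have e1 : e <= 1 / 2 by rewrite ler_wpM2r // ge_min lexx orbT.
have [t2|t2] := leP t (1 / 2).
  exists (t + e); apply: Hr.
  - by rewrite /ball /= opprD addNKr normrN gtr0_norm.
  - by rewrite /= gt_eqF // ltrDl.
  - by rewrite /I01 /= in_itv /=; apply/andP; split; lra.
exists (t - e); apply: Hr.
- by rewrite /ball /= opprB addrC subrK gtr0_norm.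
- by rewrite /= lt_eqF // ltrBlDr ltrDl.
- by rewrite /I01 /= in_itv /=; apply/andP; split; lra.
Qed.

(** Limits inside [0, 1] are unique because every point of [0, 1] is a limit of
others. *)
Lemma derive01_eq0 (g : R -> R) : {in I01, forall t, g t = 0} ->
  {in I01, forall t, derive01 g t = 0}.
Proof.
move=> g0 t t01; rewrite /derive01.
have pf := within_I01_proper (set_mem t01).
apply: cvg_lim => //; apply: (@cvg_trans _ (cst 0 @ within I01 t^')); last exact: cvg_cst.
apply: near_eq_cvg; rewrite near_withinE; near=> s => s01.
by rewrite /diff_quot !g0 ?mem_set // ?subrr ?mul0r //; exact: set_mem.
Unshelve. all: by end_near. Qed.

Lemma sobolev_norm_eq0 l (g : R -> R) : {in I01, forall t, g t = 0} ->
  sobolev_norm l g = 0.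
Proof.
move=> g0.
have dg0 k : {in I01, forall t, derive01n k g t = 0}.
  by elim: k => // k IH; exact: derive01_eq0.
have int0 (h : R -> R) : {in I01, forall t, h t = 0} -> \int[mu]_(t in I01) h t = 0.
  move=> h0; rewrite (@eq_Rintegral _ _ _ mu _ (cst 0)) // Rintegral_cst ?mul0r //.
  exact: measurable_itv.
rewrite /sobolev_norm int0 => [|t t01]; last by rewrite dg0 // expr0n.
rewrite addr0 big1 ?sqrtr0 // => k _.
by rewrite int0 ?expr0n // => t; exact: dg0.
Qed.

(** Varying one coordinate shows that each component is constant on [0, 1]; its
mean is zero, so it vanishes there. *)
Lemma cosso_penalty_constant d l (f : 'rV[R]_d -> R) : cosso_space l f ->
  constant_on_cube f -> cosso_penalty l f = 0.
Proof.
move=> ff [c fc]; have [b fE] := cosso_decomposition ff.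
apply: big1 => j _; apply: sobolev_norm_eq0 => t t01.
have [sj intj] := component_sobolev0 j ff.
pose kappa := c - b - \sum_(k | k != j) component l k f 0.
have const s : I01 s -> component l j f s = kappa.
  rewrite /I01 /= in_itv /= => s01.
  pose x : 'rV[R]_d := \row_k (if k == j then s else 0).
  have x01 : unit_cube x.
    by move=> k; rewrite mxE; case: ifP => // _; rewrite lexx ler01.
  have := fE _ x01; rewrite (fc _ x01) (bigD1 j) //= mxE eqxx.
  rewrite (eq_bigr (fun k => component l k f 0)).
    by rewrite /kappa => ->; ring.
  by move=> k /negPf kj; rewrite mxE kj.
rewrite const; last exact: set_mem.
move: intj => /=; rewrite (@eq_Rintegral _ _ _ mu _ (cst kappa)); last first.
  by move=> s /set_mem; exact: const.
rewrite Rintegral_cst; last exact: measurable_itv.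
have muI : mu I01 = 1%E.
  have := lebesgue_measure_itv (`[0, 1] : interval R).
  by rewrite /= lte_fin ltr01 oppr0 adde0.
move=> /eqP; rewrite mulf_eq0 => /orP[/eqP//|/eqP fmu].
have : fine (mu I01) = 0 := fmu.
by rewrite muI => /eqP; rewrite oner_eq0.
Qed.

End constants.

(** Both terms of the rate are at most of order tau once tau is at least of order
n^(-l/(2 l + 1)): n^(-1/2) is smaller than this order, and the first term equals
tau times ((tau^-1)^(2 l + 1) n^-l)^(1/(2 l - 1)). *)
Lemma rate_le (R : realType) (l : nat) (M : R) : (0 < l)%N -> 0 < M ->
  exists2 C : R, 0 < C & forall (n : nat) (tau : R), (0 < n)%N -> 0 < tau ->
    tau^-1 <= M * n%:R `^ (l%:R / (2 * l%:R + 1)) -> rate l n tau <= C * tau.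
Proof.
move=> l0 M0; have l1 : 1 <= l%:R :> R by rewrite ler1n.
pose q : R := 2 * l%:R - 1; pose Q : R := 2 * l%:R + 1.
have q0 : 0 < q by rewrite /q; lra.
have Q0 : 0 < Q by rewrite /Q; lra.
exists (M + M `^ (Q / q)); first by rewrite addr_gt0 // powR_gt0.
move=> n tau n0 tau0 Htau; have n1 : 1 <= n%:R :> R by rewrite ler1n.
have nR : 0 < n%:R :> R by rewrite ltr0n.
have tV : 0 < tau^-1 by rewrite invr_gt0.
rewrite /rate -/q ge_max (mulrDl M); apply/andP; split.
  apply: (@le_trans _ _ (M `^ (Q / q) * tau)); last first.
    by rewrite lerDr mulr_ge0 // ltW.
  have -> : tau `^ (- (2 / q)) = tau * (tau^-1) `^ (Q / q).
    rewrite -(powR_inv1 (ltW tau0)) -powRrM -[X in _ = X * _](powRr1 (ltW tau0)).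
    rewrite -powRD; last by rewrite (gt_eqF tau0) implybT.
    by congr (_ `^ _); rewrite /Q /q; field; rewrite /q in q0; rewrite gt_eqF.
  have : tau^-1 `^ (Q / q) <= (M * n%:R `^ (l%:R / Q)) `^ (Q / q).
    apply: ge0_ler_powR; last exact: Htau.
    - by rewrite divr_ge0 // ltW.
    - by rewrite nnegrE ltW.
    - by rewrite nnegrE mulr_ge0 ?powR_ge0 // ltW.
  rewrite powRM ?powR_ge0 ?(ltW M0) // -powRrM.
  have -> : l%:R / Q * (Q / q) = l%:R / q by rewrite mulrA divfK // gt_eqF.
  move=> h; rewrite powRN -/q mulrC -[leRHS]mulrC -!mulrA ler_wpM2l ?(ltW tau0) //.
  by rewrite ler_pdivrMr // powR_gt0.
apply: (@le_trans _ _ (M * tau)); last by rewrite lerDl mulr_ge0 ?powR_ge0 // ltW.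
apply: (@le_trans _ _ (n%:R `^ (- (l%:R / Q)))).
  apply: ler_powR => //; rewrite lerN2 ler_pdivrMr // /Q; lra.
rewrite powRN -(ler_pM2r tV) mulfK ?gt_eqF //.
by rewrite mulrC ler_pdivrMr ?powR_gt0.
Qed.

Theorem theorem2 (R : realType) (d l : nat) (hd : (1 <= d)%N) (hl : (1 <= l)%N)
    (dT : measure_display) (T : measurableType dT) (P : probability T R)
    (f0 : 'rV[R]_d -> R) (hf0 : cosso_space l f0)
    (sigma : R) (hsigma : 0 < sigma)
    (x : forall n : nat, 'I_n -> 'rV[R]_d)
    (hx : forall (n : nat) (i : 'I_n), unit_cube (x n i))
    (eps : forall n : nat, 'I_n -> {RV P >-> R})
    (heps_indep : forall n : nat, mutually_independent (eps n))
    (heps_normal : forall (n : nat) (i : 'I_n), normal_law (eps n i) 0 sigma)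
    (tau : nat -> {RV P >-> R})
    (htau : forall (n : nat) (w : T), 0 < tau n w)
    (fhat : nat -> T -> 'rV[R]_d -> R)
    (hfhat : forall (n : nat) (w : T), (0 < n)%N ->
       is_cosso_estimate l (x n) (fun i => f0 (x n i) + eps n i w)
         (tau n w) (fhat n w)) :
  (~ constant_on_cube f0 ->
   bigOp P (fun n w => (tau n w)^-1)
     (fun n _ => n%:R `^ (l%:R / (2 * l%:R + 1)) *
        cosso_penalty l f0 `^ ((2 * l%:R - 1) / (4 * l%:R + 2))) ->
   bigOp P (fun n w => empirical_norm (x n) (fhat n w \- f0))
     (fun n w => tau n w * cosso_penalty l f0 `^ (1 / 2))) /\
  (constant_on_cube f0 ->
   bigOp P (fun n w => empirical_norm (x n) (fhat n w \- f0))
     (fun n w => Num.max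
        (n%:R `^ (- (l%:R / (2 * l%:R - 1))) *
           tau n w `^ (- (2 / (2 * l%:R - 1))))
        (n%:R `^ (- (1 / 2))))).
Proof.
have emp0 n w : 0 <= empirical_norm (x n) (fhat n w \- f0) by exact: sqrtr_ge0.
set J0 := cosso_penalty l f0.
have J00 : 0 <= J0 by exact: cosso_penalty_ge0.
split=> [_ Htau|f0c] e e_gt0; last first.
  have [C C0 HC] := cosso_oracle P hl hf0 hsigma e_gt0.
  exists C => //; exists 1%N => // n /= n0.
  have [B HB Hw] := HC n (x n) (eps n) n0 (hx n) (heps_indep n) (heps_normal n).
  exists B => // w /= Hlt; apply: contrapT => wB; move: Hlt; apply/negP; rewrite -leNgt.
  have := Hw w _ _ wB (htau n w) (hfhat n w n0).
  by rewrite (cosso_penalty_constant hf0 f0c) sqrtr0 mulr0 addr0 ger0_norm.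
(* If J0 = 0 the hypothesis on tau bounds a positive number by 0, so its
   exceptional event is everything. *)
have [J0_eq0|J0_neq0] := eqVneq J0 0.
  have [C C0 HC] := Htau e e_gt0; exists 1 => //.
  apply: filterS HC => n [B HB HBw]; exists B => // w _; apply: HBw => /=.
  have l1 : 1 <= l%:R :> R by rewrite ler1n.
  have p0 : (2 * l%:R - 1) / (4 * l%:R + 2) != 0 :> R.
    by rewrite gt_eqF // divr_gt0 //; lra.
  by rewrite J0_eq0 powR0 // !mulr0 normr_gt0 invr_eq0 gt_eqF.
have J0_gt0 : 0 < J0 by rewrite lt_neqAle eq_sym J0_neq0.
have e2 : 0 < e / 2 by rewrite divr_gt0.
have [C1 C10 HC1] := Htau _ e2.
pose M := C1 * J0 `^ ((2 * l%:R - 1) / (4 * l%:R + 2)).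
have M0 : 0 < M by rewrite mulr_gt0 // powR_gt0.
have [C2 C20 HC2] := rate_le hl M0.
have [C3 C30 HC3] := cosso_oracle P hl hf0 hsigma e2.
have sJ : 0 < Num.sqrt J0 by rewrite sqrtr_gt0.
pose C := C3 * (C2 + Num.sqrt J0) / Num.sqrt J0.
exists C; first by rewrite divr_gt0 // mulr_gt0 // addr_gt0.
have npos : \forall n \near \oo, (0 < n)%N by exists 1%N.
apply: filterS2 npos HC1 => n n0 [B1 [mB1 PB1] HB1].
have [B2 [mB2 PB2] HB2] := HC3 n (x n) (eps n) n0 (hx n) (heps_indep n) (heps_normal n).
exists (B1 `|` B2).
  split; first exact: measurableU.
  apply: le_trans (measureU2 _ mB1 mB2) _.
  by rewrite [e in leRHS](splitr e) EFinD leeD.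
move=> w /= Hlt; apply: contrapT => /not_orP[wB1 wB2].
move: Hlt; apply/negP; rewrite -leNgt ger0_norm //.
apply: le_trans (HB2 w _ _ wB2 (htau n w) (hfhat n w n0)) _.
have Hinv : (tau n w)^-1 <= M * n%:R `^ (l%:R / (2 * l%:R + 1)).
  rewrite leNgt; apply/negP => h; apply: wB1; apply: HB1 => /=.
  rewrite gtr0_norm ?invr_gt0 //; apply: le_lt_trans h.
  by rewrite /M -mulrA (mulrC (n%:R `^ _)).
have Hrate := HC2 n _ n0 (htau n w) Hinv.
rewrite mul1r powR12_sqrt // -/J0.
have -> : C * (tau n w * Num.sqrt J0) = C3 * (C2 * tau n w + tau n w * Num.sqrt J0).
  by rewrite /C; field; rewrite gt_eqF.
by rewrite ler_wpM2l ?(ltW C30) // lerD2r.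
Qed.
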